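(* In the cell-probe model with $w$ bits per cell, there exist instances of the online Hamming distance problem (with parameters $n$ and $\delta$) such that any algorithm solving it has expected amortised time $\Omega\left(\frac{\delta}{w}\log n\right)$ per arriving symbol. This holds for randomised algorithms as well as deterministic ones.
   Context: Online Hamming distance problem: parameters are positive integers $n$ and $\delta$, an alphabet $\Sigma$ with $|\Sigma|\le 2^\delta$ (so $\delta$ is the number of bits needed to represent a symbol), and a fixed string $F\in\Sigma^n$. The algorithm maintains a string $S\in\Sigma^n$ subject to an operation $\mathrm{arrive}(x)$, $x\in\Sigma$, which removes the leftmost symbol $S[0]$, appends $x$ to the right of $S[n-1]$, and must then output the Hamming distance between $F$ and the updated $S$ (the number of positions $i$ with $F[i]\neq S[i]$), before the next symbol arrives. Cell-probe model: memory consists of cells of $w$ bits each, with $w\ge \log_2 n$; computation is free and the cost is the number of cells read or written (cell probes); the computing unit retains no information between operations. Time is measured as the number of cell probes.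
   Formalization: The bound is proved for δ ≤ C log n for each fixed constant C, with the constant in Ω depending on C; for unrestricted δ the claim fails, since symbols can be replaced by one of at most n+1 indices, making the time bounded in terms of n alone. *)

(* Defs.v *)
(* MathComp / MathComp-Analysis. *)
From mathcomp Require Import all_boot all_order all_algebra.
From mathcomp Require Import all_classical all_reals all_analysis.

Set Implicit Arguments.
Unset Strict Implicit.
Unset Printing Implicit Defensive.
Import Order.TTheory GRing.Theory Num.Theory.

Local Open Scope ring_scope.

Definition log2 (R : realType) (x : R) : R := ln x / ln 2.

Definition hamming (Sigma : finType) (n : nat) (F S : n.-tuple Sigma) : nat :=
  #|[set i : 'I_n | tnth F i != tnth S i]|.

Definition shift (Sigma : finType) (n : nat) (S : n.-tuple Sigma) (x : Sigma) :
    n.-tuple Sigma :=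
  [tuple of behead (rcons S x)].

Fixpoint answers (Sigma : finType) (n : nat) (F S : n.-tuple Sigma)
    (U : seq Sigma) : seq nat :=
  if U is x :: U' then
    let S' := shift S x in hamming F S' :: answers F S' U'
  else [::].

Definition cell (w : nat) := w.-tuple bool.

(* Addresses are unbounded and the contents of the memory are arbitrary before
   the first operation, so free preprocessing is allowed. *)
Definition memory (w : nat) := nat -> cell w.

(* The computation carried out during one operation, as a decision tree.  Its
   nodes depend only on what was read since the start of the operation, so
   local computation is free and unlimited. *)
Inductive probe_tree (w : nat) : Type :=
  | Output of nat
  | Read of nat & (cell w -> probe_tree w)
  | Write of nat & cell w & probe_tree w.

Definition update (w : nat) (M : memory w) (a : nat) (v : cell w) : memory w :=
  fun b => if b == a then v else M b.

Record outcome (w : nat) :=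
  Outcome { out : nat; mem_after : memory w; probes : nat }.

Fixpoint exec (w : nat) (t : probe_tree w) (M : memory w) : outcome w :=
  match t with
  | Output o => Outcome o M 0
  | Read a k =>
      let r := exec (k (M a)) M in Outcome (out r) (mem_after r) (probes r).+1
  | Write a v t' =>
      let r := exec t' (update M a v) in
      Outcome (out r) (mem_after r) (probes r).+1
  end.

(* The tree executed on arrival of [x] depends on [x] alone: nothing but the
   memory survives from one operation to the next. *)
Record algorithm (Sigma : finType) (w : nat) :=
  Algorithm { init_mem : memory w; arrive : Sigma -> probe_tree w }.

Fixpoint stream_outputs (Sigma : finType) (w : nat)
    (arr : Sigma -> probe_tree w) (M : memory w) (U : seq Sigma) : seq nat :=
  if U is x :: U' then
    let r := exec (arr x) M in out r :: stream_outputs arr (mem_after r) U'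
  else [::].

Fixpoint stream_probes (Sigma : finType) (w : nat)
    (arr : Sigma -> probe_tree w) (M : memory w) (U : seq Sigma) : nat :=
  if U is x :: U' then
    let r := exec (arr x) M in (probes r + stream_probes arr (mem_after r) U')%N
  else 0%N.

(* Correctness is required on all streams of the length [m] over which the time
   is amortised.  Hence the finiteness of the trees loses no generality: on
   streams of a fixed length an algorithm makes boundedly many probes per
   operation, and its trees can be truncated at that depth. *)
Definition solves (Sigma : finType) (n w : nat) (F S : n.-tuple Sigma)
    (m : nat) (A : algorithm Sigma w) : Prop :=
  forall U : m.-tuple Sigma,
    stream_outputs (arrive A) (init_mem A) U = answers F S U.

Definition amortised_time (R : realType) (Sigma : finType) (w m : nat)
    (A : algorithm Sigma w) (U : m.-tuple Sigma) : R :=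
  (stream_probes (arrive A) (init_mem A) U)%:R / m%:R.

Definition is_distribution (R : realType) (X : finType) (D : X -> R) : Prop :=
  (forall x, 0 <= D x) /\ \sum_x D x = 1.

(* A randomised algorithm is a random deterministic one: [A omega] has free
   access to all the random choices [omega] in every operation.  It is
   zero-error: it is correct almost surely. *)
Definition randomised_solves (R : realType) (Sigma : finType) (n w : nat)
    (F S : n.-tuple Sigma) (m : nat) (d : measure_display)
    (T : measurableType d) (P : probability T R)
    (A : T -> algorithm Sigma w) : Prop :=
  (forall U : m.-tuple Sigma,
     measurable_fun setT (fun omega => amortised_time R (A omega) U)) /\
  {ae P, forall omega, solves F S m (A omega)}.

(* Main.v *)
(** The information transfer method of Patrascu and Demaine, on the binary tree
    over the time axis whose leaves are superblocks of the stream.  At a node of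
    level [e], the cells written while reading the left child [I] and read while
    processing the right child [J] must carry all the information about [I] that
    the answers given during [J] reveal.

    To make the answers reveal [delta] bits per symbol, the pattern contains, at
    every distance [2 ^ e] superblocks from its right end, a gadget measuring the
    superblock that arrived [2 ^ e] superblocks ago.  A superblock consists of
    [K] blocks, block [k] using symbols of colour [k] only.  The gadget makes the
    answers equal to the results of weighing [K] coins, one per block, by a
    Cantor-Mills detecting matrix; since [K] coins can be found with
    [O(K / log K)] weighings, there is room to measure each of the
    [O(log K)] bits of each symbol with only [K] weighings.

    Summed over the [Omega(log n)] levels this gives the bound in terms of
    transferred cells; the costs of the levels telescope to the number of probes.
    For bounded [delta] it is enough that every arrival costs one probe. *)

Require Import Defs.
From mathcomp Require Import all_boot all_order all_algebra all_fingroup.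
From mathcomp Require Import zify ring.
Import Order.TTheory GRing.Theory Num.Theory.

(** * Detecting matrices and coin weighing *)

Section Weighing.

Local Open Scope ring_scope.

(* Cantor-Mills recursion: [A] becomes [[A, A, 1], [A, -A, 0]].  The sum of the
   two new weighings has the parity of the coin in the last group. *)
Lemma detecting_matrix (h : nat) :
  exists (Row Col : finType) (A : Row -> Col -> int),
    [/\ #|Row| = (2 ^ h)%N, (#|Col|.*2 = h.+2 * 2 ^ h)%N,
        forall r c, A r c = 0 \/ A r c = 1 \/ A r c = -1 &
        forall x y : Col -> bool,
          (forall r, \sum_c A r c * (x c)%:R = \sum_c A r c * (y c)%:R) ->
          x =1 y].
Proof.
elim: h => [|h [Row [Col [A [cR cC A01 detA]]]]].
  exists unit, unit, (fun _ _ => 1); split.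
  - by rewrite card_unit.
  - by rewrite card_unit.
  - by right; left.
  move=> x y /(_ tt); rewrite !(big_pred1 tt) ?mul1r; [|by case..].
  by move=> E [] ; move: E; case: (x tt); case: (y tt).
pose Col' : finType := ((Col + Col) + Row)%type.
pose A' (r : bool * Row) (c : Col') : int :=
  match c with
  | inl (inl c) => A r.2 c
  | inl (inr c) => if r.1 then A r.2 c else - A r.2 c
  | inr r' => (r.1 && (r.2 == r'))%:R
  end.
exists (bool * Row)%type, Col', A'; split.
- by rewrite card_prod card_bool cR expnS.
- by rewrite !card_sum cR expnS; lia.
- case=> b r [[c|c]|r'] /=.
  + exact: A01.
  + by case: b; move: (A01 r c); lia.
  + by case: (b && _); [right; left|left].
move=> x y eqxy.
have sumE b r (z : Col' -> bool) : \sum_c A' (b, r) c * (z c)%:R =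
    \sum_c A r c * (z (inl (inl c)))%:R +
    (if b then \sum_c A r c * (z (inl (inr c)))%:R
     else - \sum_c A r c * (z (inl (inr c)))%:R) +
    (b && z (inr r))%:R.
  rewrite big_sumType big_sumType /=; congr (_ + _ + _).
    by case: b => //; rewrite -sumrN; apply: eq_bigr => c _; rewrite mulNr.
  case: b => /=; last by rewrite big1 // => r' _; rewrite mul0r.
  rewrite (bigD1 r) //= eqxx mul1r big1 ?addr0 // => r' /negPf.
  by rewrite eq_sym => ->; rewrite mul0r.
have key r : [/\ \sum_c A r c * (x (inl (inl c)))%:R = \sum_c A r c * (y (inl (inl c)))%:R,
   \sum_c A r c * (x (inl (inr c)))%:R = \sum_c A r c * (y (inl (inr c)))%:R &
   x (inr r) = y (inr r)].
  have := eqxy (true, r); have := eqxy (false, r); rewrite !sumE /=.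
  by case: (x (inr r)); case: (y (inr r)) => /=; split=> //; lia.
case=> [[c|c]|r].
- by apply: (detA (fun c => x (inl (inl c))) (fun c => y (inl (inl c)))) => r; case: (key r).
- by apply: (detA (fun c => x (inl (inr c))) (fun c => y (inl (inr c)))) => r; case: (key r).
- by case: (key r).
Qed.

Definition bit (b x : nat) : bool := odd (x %/ 2 ^ b).

Lemma bit_inj (beta x y : nat) : (x < 2 ^ beta)%N -> (y < 2 ^ beta)%N ->
  (forall b, (b < beta)%N -> bit b x = bit b y) -> x = y.
Proof.
elim: beta x y => [|beta IH] x y.
  by rewrite expn0 !ltnS !leqn0 => /eqP -> /eqP ->.
rewrite expnS => xlt ylt eqb.
have := eqb 0%N isT; rewrite /bit expn0 !divn1 => eqo.
have : x./2 = y./2.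
  apply: IH => [||b bb]; [lia..|].
  by have := eqb b.+1 bb; rewrite /bit expnS !divnMA !divn2.
by move=> E; rewrite -(odd_double_half x) -(odd_double_half y) eqo E.
Qed.

(* Weighing [s] is a sign, a row of the detecting matrix and a bit position: the
   positive and the negative entries of the row are weighed separately, and only
   the coins whose value has the given bit set are put on the scale. *)
Lemma weighing (beta : nat) : (0 < beta)%N ->
  let K := (beta * 2 ^ (4 * beta - 1))%N in
  exists f : nat -> nat -> nat -> bool,
    (forall s k, f s k 0%N = false) /\
    forall x y : nat -> nat,
      (forall k, (k < K)%N -> (x k < 2 ^ beta)%N) ->
      (forall k, (k < K)%N -> (y k < 2 ^ beta)%N) ->
      (forall s, (s < K)%N ->
        (\sum_(k < K) f s k (x k) = \sum_(k < K) f s k (y k))%N) ->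
      forall k, (k < K)%N -> x k = y k.
Proof.
move=> beta_gt0 K.
(* At this height there are [4 * beta * 2 ^ (4 * beta - 2) / 2 = K] columns, and the rows, taken
   with 2 signs and [beta] bit positions, also number [K]. *)
have [Row [Col [A [cR cC A01 detA]]]] := detecting_matrix (4 * beta - 2).
pose Row' : finType := (bool * Row * 'I_beta)%type.
have cR' : #|Row'| = K.
  rewrite !card_prod card_bool card_ord cR /K mulnC.
  by rewrite -expnS; congr (_ * 2 ^ _)%N; lia.
have cC' : #|Col| = K.
  apply: double_inj; rewrite cC /K -muln2 -mulnA -expnSr.
  have -> : ((4 * beta - 1).+1 = (4 * beta - 2).+2)%N by lia.
  rewrite expnS [(2 ^ _.+1)%N]expnS !mulnA; congr (_ * _)%N; lia.
pose f s k x :=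
  if (@insub _ (fun i => i < #|Row'|)%N 'I_#|Row'| s, @insub _ (fun i => i < #|Col|)%N 'I_#|Col| k)
  is (Some s', Some k') then
    let: (sg, r, b) := enum_val s' in
    (A r (enum_val k') == if sg then 1%R else (-1)%R :> int) && bit b x
  else false.
exists f; split=> [s k|x y xlt ylt eqxy].
  rewrite /f; case: insub => // s'; case: insub => // k'.
  by case: (enum_val s') => [[sg r] b]; rewrite /bit div0n andbF.
have sumf (z : nat -> nat) (s' : Row') : (\sum_(k < K) f (enum_rank s') k (z k) =
    \sum_(c : Col) ((A s'.1.2 c == if s'.1.1 then 1%R else (-1)%R :> int) &&
                   bit s'.2 (z (enum_rank c))))%N.
  rewrite (reindex (fun i : 'I_#|Col| => enum_val i)) /=; last first.
    by apply: onW_bij; apply: enum_val_bij.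
  rewrite -(big_mkord xpredT (fun k => f (enum_rank s') k (z k) : nat)) -cC' big_mkord.
  apply: eq_bigr => k _.
  rewrite /f !valK enum_valK enum_rankK.
  by case: s' => [[sg r] b].
move=> k; rewrite -cC' => klt.
suff : forall c : Col, x (enum_rank c) = y (enum_rank c).
  by move=> /(_ (enum_val (Ordinal klt))); rewrite enum_valK.
move=> c.
have clt c' : (@enum_rank Col c' < K)%N by rewrite -cC'.
apply: (@bit_inj beta); [exact: xlt|exact: ylt|].
move=> b blt.
apply: (detA (fun c => bit b (x (enum_rank c))) (fun c => bit b (y (enum_rank c)))) => r.
have Aint (z : nat -> nat) : \sum_c0 A r c0 * (bit b (z (enum_rank c0)))%:R =
   (\sum_(c : Col) ((A r c == 1%R) && bit b (z (enum_rank c))))%N%:R -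
   (\sum_(c : Col) ((A r c == (-1)%R) && bit b (z (enum_rank c))))%N%:R :> int.
  rewrite !natr_sum -sumrB; apply: eq_bigr => c' _.
  by have [->|[->|->]] := A01 r c'; case: bit.
have Hs sg : (enum_rank ((sg, r, Ordinal blt) : Row') < K)%N.
  by rewrite -cR'.
rewrite !Aint; have := eqxy _ (Hs true); have := eqxy _ (Hs false).
by rewrite !sumf /= => -> ->.
Qed.

End Weighing.

(** * Division with remainder and powers of 2 *)

Lemma divmod_unique (d a b r : nat) : r < d -> a = b * d + r -> (a %/ d = b) * (a %% d = r).
Proof.
move=> rd ->; rewrite divnMDl ?(leq_ltn_trans _ rd) // divn_small // addn0.
by rewrite modnMDl modn_small.
Qed.

Definition is_pow2 (c : nat) : bool := c == 2 ^ trunc_log 2 c.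

Lemma is_pow2_exp (e : nat) : is_pow2 (2 ^ e).
Proof. by rewrite /is_pow2 trunc_expnK. Qed.

(** The interval lies strictly between [2 ^ e.-1] and [2 ^ e.+1]. This isolates a single unknown
    superblock among those at a distance that the pattern measures. *)
Lemma is_pow2_eq (e c : nat) : 0 < e -> is_pow2 c ->
  2 ^ e.-1 < c -> c < 2 ^ e + 2 ^ e.-1 -> c = 2 ^ e.
Proof.
move=> e_gt0 /eqP cE lo hi.
set g := trunc_log 2 c in cE.
have : e.-1 < g by rewrite -(@ltn_exp2l 2) // -cE.
have : g < e.+1.
  rewrite -(@ltn_exp2l 2) // -cE (leq_trans hi) // expnS mul2n -addnn leq_add2l.
  by rewrite leq_exp2l // leq_pred.
by move=> ? ?; rewrite cE; congr (2 ^ _); lia.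
Qed.

(** * Layout of pattern and stream, and decoding of one superblock *)

Section Layout.

Variables (K q : nat) (f : nat -> nat -> nat -> bool).
Hypotheses (K_gt1 : 1 < K) (q_gt0 : 0 < q) (f0 : forall s k, f s k 0 = false).

(** Coins sit at positions below [K * q] and codes are below [2 * K * q], so position plus code
    never carries into the next block. *)
Definition block : nat := 4 * K * q.
Definition superblock : nat := K * block.

(* Symbols are numbers below [2 * K * q]; [k + K * x] is the value [x > 0] of
   colour [k], and 0 and 1 are fillers of the stream and of the pattern.  [v] is
   the distance from the right end, written as
   [v = c * superblock + (s - k) * block + (k + K * x)]: block [k] meets there
   the part of the gadget for weighing [s], [c] superblocks after its arrival. *)
Definition pattern (v : nat) : nat :=
  let r := v %% block in
  let b := v %/ block + r %% K in
  if [&& r < 2 * K * q, is_pow2 (b %/ K) & f (b %% K) (r %% K) (r %/ K)]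
  then r else 1.

(* The value carried at position [j = i * K + rho] of a block with permutations
   [p rho].  It meets its match in the pattern at a time determined by
   [p rho i] and [rho], so no two positions of a block match simultaneously. *)
Definition coin (p : nat -> nat -> nat) (j : nat) : nat :=
  p (j %% K) (j %/ K) + q - j %/ K.

Definition stream_symbol (p : nat -> nat -> nat -> nat -> nat) (u : nat) : nat :=
  let k := u %/ block %% K in
  let j := u %% block in
  if j < K * q then k + K * coin (p (u %/ superblock) k) j else 0.

Definition is_perm (p : nat -> nat -> nat) : Prop :=
  forall rho, rho < K ->
    (forall i, i < q -> p rho i < q) /\
    (forall i j, i < q -> j < q -> p rho i = p rho j -> i = j).

(** The offset [q] in [coin] keeps the subtraction from being truncated and the value positive,
    hence distinct from the weightless 0. *)
Lemma coin_bounds (p : nat -> nat -> nat) (j : nat) : is_perm p -> j < K * q ->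
  0 < coin p j < 2 * q.
Proof.
move=> pP jlt; rewrite /coin.
have iq : j %/ K < q by rewrite ltn_divLR ?(ltnW K_gt1) // mulnC.
have /pP[/(_ _ iq) plt _] : j %% K < K by rewrite ltn_mod (ltnW K_gt1).
move: iq plt; set a := p _ _; move: (j %/ K) a => b a; lia.
Qed.

Lemma block_gt0 : 0 < block. Proof. by rewrite /block; nia. Qed.

Lemma code_lt (k x j : nat) : k < K -> x < 2 * q -> j < K * q ->
  (k + K * x < 2 * K * q) /\ (j + (k + K * x) < block).
Proof. rewrite /block; nia. Qed.

Lemma pattern_code (b k x : nat) : k < K -> x < 2 * q -> 0 < x ->
  (pattern (b * block + (k + K * x)) == k + K * x) =
  is_pow2 ((b + k) %/ K) && f ((b + k) %% K) k x.
Proof.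
move=> kK xq x_gt0; rewrite /pattern.
have [rlt rW] := code_lt k x 0 kK xq ltac:(nia).
have [-> ->] := divmod_unique block _ b (k + K * x) rW erefl.
have [-> ->] := divmod_unique K (k + K * x) x k kK ltac:(lia).
rewrite rlt /=; case: ifP => _; first by rewrite eqxx.
(* The filler 1 is no code: [K > 1] and [x > 0] give [k + K * x > 1]. *)
by apply/negbTE/eqP; nia.
Qed.

(** So the stream filler 0 never matches: at remainder 0 the gadget would have to weigh the value 0,
    which [f0] excludes. *)
Lemma pattern_neq0 (v : nat) : pattern v != 0.
Proof.
rewrite /pattern; case: ifP => // /and3P[_ _]; apply: contraL => /eqP ->.
by rewrite div0n f0.
Qed.

(** Apart from the filler 1, a symbol of the pattern is its own position in the block, so a match
    fixes the distance modulo [block]. *)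
Lemma pattern_mod (v : nat) (r : nat) : pattern v = r -> K <= r -> v %% block = r.
Proof. by rewrite /pattern; case: ifP => // _ <-; lia. Qed.

Lemma pattern_lt (v : nat) : pattern v < 2 * K * q.
Proof. by rewrite /pattern; case: ifP => [/and3P[]//|_]; nia. Qed.

(** Add [u = (sg * K + k) * block + j] and [t - u = b * block + (k + K * x)]: the low digits do not
    carry and the block indices sum to [sg * K + (b + k)]. As the pattern is indexed by [b + k], all
    [K] blocks of a superblock meet the same weighing at time [t], the one numbered
    [t %/ block %% K]. *)
Lemma match_iff (p : nat -> nat -> nat -> nat -> nat) (u t : nat) :
  (forall sg k, k < K -> is_perm (p sg k)) -> u <= t ->
  let k := u %/ block %% K in
  let j := u %% block in
  let x := coin (p (u %/ superblock) k) j in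
  (stream_symbol p u == pattern (t - u)) =
  [&& j < K * q, is_pow2 (t %/ superblock - u %/ superblock),
      t %% block == j + (k + K * x) & f (t %/ block %% K) k x].
Proof.
move=> pP ut k j x; rewrite /stream_symbol -/k -/j -/x.
have K_gt0 : 0 < K by lia.
case: ifP => [jlt|_] /=; last by rewrite eq_sym (negbTE (pattern_neq0 _)).
have kK : k < K by rewrite ltn_mod.
have /andP[x_gt0 xq] : 0 < x < 2 * q by apply: coin_bounds => //; apply: pP.
have [rlt rW] := code_lt k x j kK xq jlt.
have uE : u = (u %/ superblock * K + k) * block + j.
  rewrite {1}(divn_eq u block) -/j; congr (_ * _ + _).
  by rewrite {1}(divn_eq (u %/ block) K) -/k /superblock [K * block]mulnC divnMA.
have tE : t = (t %/ superblock * K + t %/ block %% K) * block + t %% block.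
  rewrite {1}(divn_eq t block); congr (_ * _ + _).
  by rewrite {1}(divn_eq (t %/ block) K) /superblock [K * block]mulnC divnMA.
have sK : t %/ block %% K < K by rewrite ltn_mod.
set sg := u %/ superblock in uE *; set T := t %/ superblock in tE *.
set s := t %/ block %% K in tE sK *.
have tauW : t %% block < block by rewrite ltn_mod block_gt0.
set tau := t %% block in tE tauW *.
apply/idP/idP => [/eqP H|/and3P[pw /eqP tauE fx]].
  have r_ge : K <= k + K * x by rewrite (leq_trans _ (leq_addl _ _)) // leq_pmulr.
  have vm := pattern_mod _ _ (esym H) r_ge.
  set b := (t - u) %/ block.
  have vE : t - u = b * block + (k + K * x) by rewrite {1}(divn_eq (t - u) block) vm.
  have tE2 : t = (sg * K + (b + k)) * block + (j + (k + K * x)).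
    by rewrite -(subnKC ut) vE {1}uE; ring.
  have [tb tm] := divmod_unique block t (sg * K + (b + k)) (j + (k + K * x)) rW tE2.
  move/eqP: H; rewrite vE eq_sym pattern_code // => /andP[pw fx].
  rewrite /tau tm eqxx /s tb modnMDl fx andbT /= andbT.
  by rewrite /T /superblock [K * block]mulnC divnMA tb divnMDl // addKn.
(* A power of 2 is positive, so [(T - sg) * K + s - k] is not truncated. *)
have pw0 : sg < T.
  by rewrite -subn_gt0; move: pw; rewrite /is_pow2 => /eqP ->; rewrite expn_gt0.
have vE : t - u = ((T - sg) * K + s - k) * block + (k + K * x).
  rewrite {1}tE {1}uE tauE.
  have D0 : 0 < T - sg by rewrite subn_gt0.
  rewrite -{1}(subnK (ltnW pw0)); move: (T - sg) D0 => D D0.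
  have [z eDs] : exists z, D * K + s = z + k.
    exists (D * K + s - k); rewrite subnK //.
    by rewrite (leq_trans (ltnW kK)) // (leq_trans _ (leq_addr _ _)) // leq_pmull.
  have -> : (D + sg) * K + s = D * K + s + sg * K by ring.
  rewrite eDs addnK.
  have -> : (z + k + sg * K) * block + (j + (k + K * x)) =
     z * block + (k + K * x) + ((sg * K + k) * block + j) by ring.
  by rewrite addnK.
rewrite vE eq_sym pattern_code //.
have -> : (T - sg) * K + s - k + k = (T - sg) * K + s.
  rewrite subnK // (leq_trans (ltnW kK)) // (leq_trans _ (leq_addr _ _)) //.
  by rewrite leq_pmull // subn_gt0.
have [-> ->] := divmod_unique K _ (T - sg) s sK erefl.
by rewrite pw fx.
Qed.

Lemma coin_time (p : nat -> nat -> nat) (j : nat) : is_perm p -> j < K * q ->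
  j + K * coin p j = (p (j %% K) (j %/ K) + q) * K + j %% K.
Proof.
move=> pP jlt; rewrite /coin; have iq : j %/ K < q by rewrite ltn_divLR ?(ltnW K_gt1) // mulnC.
rewrite {1}(divn_eq j K); move: iq; set a := p _ _; move: (j %/ K) (j %% K) a => i r a iq.
have [z ->] : exists z, a + q = z + i by exists (a + q - i); lia.
by rewrite addnK; ring.
Qed.

Lemma coin_time_inj (p : nat -> nat -> nat) (j j' : nat) :
  is_perm p -> j < K * q -> j' < K * q ->
  j + K * coin p j = j' + K * coin p j' -> j = j'.
Proof.
move=> pP jlt jlt'; rewrite !coin_time // => E.
have K_gt0 : 0 < K by apply: ltnW.
have rK : j %% K < K by rewrite ltn_mod.
have rK' : j' %% K < K by rewrite ltn_mod.
have [d1 m1] := divmod_unique K _ (p (j %% K) (j %/ K) + q) _ rK erefl.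
have [d2 m2] := divmod_unique K _ (p (j' %% K) (j' %/ K) + q) _ rK' erefl.
have Em : j %% K = j' %% K by rewrite -m1 E m2.
have /addIn Ed : p (j %% K) (j %/ K) + q = p (j' %% K) (j' %/ K) + q by rewrite -d1 E d2.
have Ei : j %/ K = j' %/ K.
  have [_ inj] := pP _ rK; apply: inj; last by rewrite Ed -Em.
    by rewrite ltn_divLR // mulnC.
  by rewrite ltn_divLR // mulnC.
by rewrite (divn_eq j K) (divn_eq j' K) -Em Ei.
Qed.

(* At most one [j] contributes; without one, the value is 0, which weighs nothing. *)
Definition coin_at (p : nat -> nat -> nat) (k tau : nat) : nat :=
  \sum_(j < K * q | tau == j + (k + K * coin p j)) coin p j.

Lemma coin_at_eq (p : nat -> nat -> nat) (k j : nat) : is_perm p -> j < K * q ->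
  coin_at p k (j + (k + K * coin p j)) = coin p j.
Proof.
move=> pP jlt; rewrite /coin_at (big_pred1 (Ordinal jlt)) // => j' /=.
apply/eqP/eqP => [E|->//]; apply/val_inj/esym => /=.
by apply: (coin_time_inj p) => //; lia.
Qed.

Lemma coin_at_none (p : nat -> nat -> nat) (k tau : nat) :
  (forall j, j < K * q -> tau <> j + (k + K * coin p j)) -> coin_at p k tau = 0.
Proof. by move=> H; rewrite /coin_at big_pred0 // => j; apply/eqP/H. Qed.

Lemma coin_atP (p : nat -> nat -> nat) (k tau : nat) : is_perm p ->
  (exists2 j, j < K * q & tau = j + (k + K * coin p j)) \/
  (forall j, j < K * q -> tau <> j + (k + K * coin p j)).
Proof.
move=> pP; case: (pickP (fun j : 'I_(K * q) => tau == j + (k + K * coin p j))).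
  by move=> j /eqP E; left; exists j.
by move=> H; right => j jlt; apply/eqP; rewrite (H (Ordinal jlt)).
Qed.

Lemma coin_at_lt (p : nat -> nat -> nat) (k tau : nat) :
  is_perm p -> coin_at p k tau < 2 * q.
Proof.
move=> pP; case: (coin_atP p k tau pP) => [[j jlt ->]|H].
  by rewrite coin_at_eq //; case/andP: (coin_bounds p j pP jlt).
by rewrite coin_at_none //; lia.
Qed.

Lemma sum_coin (p : nat -> nat -> nat) (s k tau : nat) : is_perm p ->
  \sum_(j < K * q) ((tau == j + (k + K * coin p j)) && f s k (coin p j)) =
  f s k (coin_at p k tau).
Proof.
move=> pP; case: (coin_atP p k tau pP) => [[j jlt ->]|H].
  rewrite coin_at_eq // (bigD1 (Ordinal jlt)) //= eqxx big1 ?addn0 // => j' nej.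
  case: eqP => //= E; case/eqP: nej; apply/val_inj/esym => /=.
  by apply: (coin_time_inj p) => //; lia.
rewrite coin_at_none // f0 big1 // => j _.
by case: eqP => // E; case: (H j).
Qed.

(** By [match_iff], only the coin of block [k] due at [t %% block] can match, and it does so exactly
    if the weighing puts it on the scale; fillers add nothing. *)
Lemma sum_superblock (p : nat -> nat -> nat -> nat -> nat) (sg t : nat) :
  (forall sg k, k < K -> is_perm (p sg k)) -> sg < t %/ superblock ->
  is_pow2 (t %/ superblock - sg) ->
  \sum_(0 <= r < superblock)
    (stream_symbol p (sg * superblock + r) == pattern (t - (sg * superblock + r))) =
  \sum_(k < K) f (t %/ block %% K) k (coin_at (p sg k) k (t %% block)).
Proof.
move=> pP sgT pw.
have ltt r : r < superblock -> sg * superblock + r <= t.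
  move=> rL; rewrite [t](divn_eq t superblock).
  have : sg.+1 * superblock <= t %/ superblock * superblock by rewrite leq_mul2r sgT orbT.
  by rewrite mulSn; lia.
rewrite {1}/superblock big_nat_mul big_mkord; apply: eq_bigr => k _.
have kK : k < K := ltn_ord k.
rewrite -(sum_coin (p sg k) _ k) //; last exact: pP.
have term j : j < block ->
  (stream_symbol p (sg * superblock + (j + k * block)) ==
     pattern (t - (sg * superblock + (j + k * block)))) =
  [&& j < K * q, t %% block == j + (k + K * coin (p sg k) j) &
      f (t %/ block %% K) k (coin (p sg k) j)].
  move=> jW; rewrite match_iff //; last first.
    by apply: ltt; rewrite /superblock; move: (ltn_ord k) jW; clear; nia.
  have uE : sg * superblock + (j + k * block) = (sg * K + k) * block + j.
    by rewrite /superblock; ring.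
  have [-> ->] := divmod_unique block _ _ j jW uE.
  have [dk mk] := divmod_unique K (sg * K + k) sg k kK erefl.
  have -> : (sg * superblock + (j + k * block)) %/ superblock = sg.
    by rewrite uE /superblock [K * block]mulnC divnMA (divmod_unique block _ _ j jW erefl).1 dk.
  by rewrite mk pw.
have Kqb : K * q <= block by rewrite /block; clear; nia.
rewrite -{1}[k * block]add0n mulSn big_addn addnK (big_cat_nat (leq0n _) Kqb) //=.
rewrite [X in _ + X = _]big_nat_cond [X in _ + X = _]big1 ?addn0 => [|j]; last first.
  by rewrite andbT => /andP[lo hi]; rewrite term // ltnNge lo.
rewrite big_mkord; apply: eq_bigr => j _.
by rewrite term ?ltn_ord // (leq_trans (ltn_ord j)).
Qed.

(** When a coin of [p] shows, [p'] shows one of the same positive value. Time and value give back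
    the position, and position and value the entry of the permutation. *)
Lemma coin_at_inj (p p' : nat -> nat -> nat) (k rho i : nat) :
  is_perm p -> is_perm p' -> k < K -> rho < K -> i < q ->
  (forall tau, tau < block -> coin_at p k tau = coin_at p' k tau) ->
  p rho i = p' rho i.
Proof.
move=> pP pP' kK rK iq eqc.
have K_gt0 : 0 < K by apply: ltnW.
have [dj mj] := divmod_unique K (i * K + rho) i rho rK erefl.
set j := i * K + rho in dj mj.
have jlt : j < K * q by rewrite /j; move: iq rK; clear; nia.
have /andP[x_gt0 xq] := coin_bounds p j pP jlt.
have [_ tauW] := code_lt k _ j kK xq jlt.
have := eqc _ tauW; rewrite coin_at_eq //.
case: (coin_atP p' k (j + (k + K * coin p j)) pP') => [[j' jlt' E]|H].
  rewrite E coin_at_eq // => Ec.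
  have Et : j + K * coin p j = j' + K * coin p' j' by lia.
  have Ejj : j = j' by move: Et; rewrite Ec; lia.
  by move: Ec; rewrite -Ejj /coin dj mj; lia.
by rewrite coin_at_none // => x0; rewrite x0 in x_gt0.
Qed.

Hypothesis weigh : forall x y : nat -> nat,
  (forall k, k < K -> x k < 2 * q) -> (forall k, k < K -> y k < 2 * q) ->
  (forall s, s < K -> \sum_(k < K) f s k (x k) = \sum_(k < K) f s k (y k)) ->
  forall k, k < K -> x k = y k.

(** For a fixed [tau], the times [(T * K + s) * block + tau] with [s < K] supply all [K] weighings
    of the same [K] coins, so [weigh] recovers them. *)
Lemma decode (p p' : nat -> nat -> nat -> nat -> nat) (sg T : nat) :
  (forall sg k, k < K -> is_perm (p sg k)) ->
  (forall sg k, k < K -> is_perm (p' sg k)) -> sg < T -> is_pow2 (T - sg) ->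
  (forall t, t %/ superblock = T ->
    \sum_(0 <= r < superblock)
      (stream_symbol p (sg * superblock + r) == pattern (t - (sg * superblock + r))) =
    \sum_(0 <= r < superblock)
      (stream_symbol p' (sg * superblock + r) == pattern (t - (sg * superblock + r)))) ->
  forall k rho i, k < K -> rho < K -> i < q -> p sg k rho i = p' sg k rho i.
Proof.
move=> pP pP' sgT pw eqs k rho i kK rK iq.
apply: (coin_at_inj (p sg k) (p' sg k) k) => //; [exact: pP|exact: pP'|].
move=> tau tauW.
apply: (weigh (fun k => coin_at (p sg k) k tau) (fun k => coin_at (p' sg k) k tau)) => //.
- by move=> k' k'K; apply: coin_at_lt; apply: pP.
- by move=> k' k'K; apply: coin_at_lt; apply: pP'.
move=> s sK.
pose t := (T * K + s) * block + tau.
have [tb tm] := divmod_unique block t _ tau tauW erefl.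
have [TK sm] := divmod_unique K _ T s sK erefl.
have tT : t %/ superblock = T by rewrite /superblock [K * block]mulnC divnMA tb TK.
have := eqs t tT; rewrite !sum_superblock ?tT //.
by rewrite tb tm sm.
Qed.

End Layout.

(** * Traces, fresh reads and simulation from transferred cells *)

Section CellProbe.

Context {w : nat}.

Fixpoint trace (t : probe_tree w) (M : memory w) : seq (bool * nat) :=
  match t with
  | Output _ => [::]
  | Read a k => (false, a) :: trace (k (M a)) M
  | Write a v t' => (true, a) :: trace t' (update M a v)
  end.

Lemma size_trace (t : probe_tree w) (M : memory w) :
  size (trace t M) = probes (exec t M).
Proof. by elim: t M => //= [a k IH|a v t IH] M; rewrite IH. Qed.

Lemma exec_untouched (t : probe_tree w) (M : memory w) (a : nat) :
  a \notin unzip2 (trace t M) -> mem_after (exec t M) a = M a.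
Proof.
elim: t M => //= [b k IH|b v t IH] M; rewrite inE negb_or => /andP[nab /IH ->] //.
by rewrite /update (negbTE nab).
Qed.

(** With [acc] empty, these are the cells whose first access is a read: the only reads that see the
    memory from before the trace. *)
Fixpoint fresh (acc : seq nat) (tr : seq (bool * nat)) : seq nat :=
  if tr is (wr, a) :: tr' then
    if a \in acc then fresh acc tr'
    else if wr then fresh (a :: acc) tr' else a :: fresh (a :: acc) tr'
  else [::].

Definition nfresh (tr : seq (bool * nat)) : nat := size (fresh [::] tr).

Lemma fresh_filter (acc A B : seq nat) (tr : seq (bool * nat)) :
  acc =i A ++ B -> fresh acc tr = [seq a <- fresh B tr | a \notin A].
Proof.
elim: tr acc A B => //= -[wr a] tr IH acc A B eqacc.
have consE : a :: acc =i A ++ a :: B.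
  by move=> b; rewrite !(inE, mem_cat) eqacc mem_cat orbCA.
rewrite eqacc mem_cat; case: (boolP (a \in B)) => aB.
  by rewrite orbT; apply: IH.
rewrite orbF; case: (boolP (a \in A)) => aA.
  have accE : acc =i A ++ a :: B.
    by move=> b; rewrite -consE inE; case: eqP => // ->; rewrite eqacc mem_cat aA.
  by case: wr; rewrite /= ?aA; apply: IH.
by case: wr; rewrite /= ?aA; [|congr cons]; apply: IH.
Qed.

Lemma eq_fresh (acc acc' : seq nat) (tr : seq (bool * nat)) :
  acc =i acc' -> fresh acc tr = fresh acc' tr.
Proof.
move=> E; rewrite (fresh_filter acc [::] acc') // filter_predT //.
Qed.

Lemma fresh_cat (acc : seq nat) (tr1 tr2 : seq (bool * nat)) :
  fresh acc (tr1 ++ tr2) = fresh acc tr1 ++ fresh (unzip2 tr1 ++ acc) tr2.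
Proof.
elim: tr1 acc => //= -[wr a] tr1 IH acc /=.
have E1 : unzip2 tr1 ++ a :: acc =i a :: (unzip2 tr1 ++ acc).
  by move=> b; rewrite !(inE, mem_cat) orbCA.
case: ifP => aacc.
  rewrite IH; congr (_ ++ _); apply: eq_fresh => b.
  by rewrite !(inE, mem_cat); case: eqP => // ->; rewrite aacc orbT.
by case: wr; rewrite IH (eq_fresh _ _ _ E1).
Qed.

(* Cells transferred from [tr1] to [tr2] are paid for by fresh reads lost in the
   concatenation. *)
Lemma nfresh_cat (tr1 tr2 : seq (bool * nat)) :
  nfresh (tr1 ++ tr2) + count [in unzip2 tr1] (fresh [::] tr2) =
  nfresh tr1 + nfresh tr2.
Proof.
rewrite /nfresh fresh_cat size_cat (fresh_filter (unzip2 tr1 ++ [::]) (unzip2 tr1) [::]) //.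
rewrite size_filter -addnA; congr (_ + _).
by rewrite addnC -[RHS](count_predC [in unzip2 tr1]).
Qed.

Lemma nfresh_le (tr : seq (bool * nat)) : nfresh tr <= size tr.
Proof.
suff H acc : size (fresh acc tr) <= size tr by apply: H.
elim: tr acc => //= -[wr a] tr IH acc.
by case: ifP => _; [|case: wr]; rewrite ?ltnS //; apply: leqW.
Qed.

Definition snapshot (M0 M1 : memory w) (a : nat) : option (cell w) :=
  if M1 a == M0 a then None else Some (M1 a).

Lemma snapshot_inj (M0 M1 M1' : memory w) (a : nat) :
  snapshot M0 M1 a = snapshot M0 M1' a -> M1 a = M1' a.
Proof.
by rewrite /snapshot; case: eqP => [->|_]; case: eqP => [->|_] //; case.
Qed.

(** The two runs proceed in lockstep: a read in [acc] returns equal values by assumption, and any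
    other read is fresh, its value being determined by the head of the common code. The tails [r]
    and [r'] are left for the following operations. *)
Lemma exec_det (M0 M1 M1' : memory w) (t : probe_tree w) (acc : seq nat)
    (M M' : memory w) (r r' : seq (option (cell w))) :
  {in acc, M =1 M'} ->
  (forall a, a \notin acc -> M a = M1 a) ->
  (forall a, a \notin acc -> M' a = M1' a) ->
  map (snapshot M0 M1) (fresh acc (trace t M)) ++ r =
    map (snapshot M0 M1') (fresh acc (trace t M')) ++ r' ->
  [/\ out (exec t M) = out (exec t M'), trace t M = trace t M', r = r' &
      {in unzip2 (trace t M) ++ acc, mem_after (exec t M) =1 mem_after (exec t M')}].
Proof.
elim: t acc M M' => [o|a k IH|a v t IH] acc M M' eqacc E1 E1' /=.
- by move=> ->; split.
- case: (boolP (a \in acc)) => aacc.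
    move=> H; have eqa := eqacc _ aacc; rewrite -eqa in H *.
    have [-> tE -> mE] := IH _ _ _ _ eqacc E1 E1' H.
    split=> //; first by rewrite tE.
    by move=> b; rewrite inE => /predU1P[->|/mE//]; apply: mE; rewrite mem_cat aacc orbT.
  rewrite map_cons /= => -[/snapshot_inj].
  rewrite -(E1 _ aacc) -(E1' _ aacc) => eqa; rewrite -eqa => H.
  have [|b|b|-> tE -> mE] := IH _ _ _ _ _ _ _ H.
  + by move=> b; rewrite inE => /predU1P[->|/eqacc].
  + by rewrite inE negb_or => /andP[_ /E1].
  + by rewrite inE negb_or => /andP[_ /E1'].
  split=> //; first by rewrite tE.
  by move=> b; rewrite inE => bb; apply: mE; rewrite mem_cat inE orbCA -mem_cat.
- have H0 : fresh acc ((true, a) :: trace t (update M a v)) =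
      fresh (a :: acc) (trace t (update M a v)).
    rewrite /=; case: ifP => // aacc; apply: eq_fresh => b.
    by rewrite inE; case: eqP => // ->; rewrite aacc.
  have H0' : fresh acc ((true, a) :: trace t (update M' a v)) =
      fresh (a :: acc) (trace t (update M' a v)).
    rewrite /=; case: ifP => // aacc; apply: eq_fresh => b.
    by rewrite inE; case: eqP => // ->; rewrite aacc.
  move: H0 H0' => /= -> -> H.
  have [|b|b|-> tE -> mE] := IH _ _ _ _ _ _ H.
  + move=> b; rewrite inE /update; case: eqP => //= _; exact: eqacc.
  + by rewrite inE negb_or /update => /andP[/negbTE -> /E1].
  + by rewrite inE negb_or /update => /andP[/negbTE -> /E1'].
  split=> //; first by rewrite tE.
  by move=> b; rewrite inE => bb; apply: mE; rewrite mem_cat inE orbCA -mem_cat.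
Qed.

Context {Sigma : finType}.
Variable arr : Sigma -> probe_tree w.

Fixpoint stream_memory (M : memory w) (U : seq Sigma) : memory w :=
  if U is x :: U' then stream_memory (mem_after (exec (arr x) M)) U' else M.

Fixpoint stream_trace (M : memory w) (U : seq Sigma) : seq (bool * nat) :=
  if U is x :: U' then
    trace (arr x) M ++ stream_trace (mem_after (exec (arr x) M)) U'
  else [::].

Lemma stream_memory_cat M U V :
  stream_memory M (U ++ V) = stream_memory (stream_memory M U) V.
Proof. by elim: U M => /=. Qed.

Lemma stream_trace_cat M U V :
  stream_trace M (U ++ V) = stream_trace M U ++ stream_trace (stream_memory M U) V.
Proof. by elim: U M => //= x U IH M; rewrite IH catA. Qed.

Lemma stream_outputs_cat M U V :
  stream_outputs arr M (U ++ V) =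
  stream_outputs arr M U ++ stream_outputs arr (stream_memory M U) V.
Proof. by elim: U M => //= x U IH M; rewrite IH. Qed.

Lemma size_stream_outputs M U : size (stream_outputs arr M U) = size U.
Proof. by elim: U M => //= x U IH M; rewrite IH. Qed.

Lemma size_stream_trace M U : size (stream_trace M U) = stream_probes arr M U.
Proof. by elim: U M => //= x U IH M; rewrite size_cat size_trace IH. Qed.

Lemma stream_untouched M U a :
  a \notin unzip2 (stream_trace M U) -> stream_memory M U a = M a.
Proof.
elim: U M => //= x U IH M; rewrite /unzip2 map_cat mem_cat negb_or.
by move=> /andP[na /IH ->]; apply: exec_untouched.
Qed.

(* What one who knows the memory [M0] has to be told to process [U] from [M1].
   Addresses are unbounded, so the changed cells are not listed with their
   addresses: instead every fresh read comes with a flag. *)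
Definition transfer (M0 M1 : memory w) (U : seq Sigma) : seq (option (cell w)) :=
  map (snapshot M0 M1) (fresh [::] (stream_trace M1 U)).

Lemma transfer_det (M0 M1 M1' : memory w) (U : seq Sigma) :
  transfer M0 M1 U = transfer M0 M1' U ->
  stream_outputs arr M1 U = stream_outputs arr M1' U.
Proof.
rewrite /transfer.
(* Generalised to the middle of a run: the memories agree on the cells [acc] accessed so far and are
   still the initial ones elsewhere. *)
suff H acc M M' : {in acc, M =1 M'} ->
    (forall a, a \notin acc -> M a = M1 a) ->
    (forall a, a \notin acc -> M' a = M1' a) ->
    map (snapshot M0 M1) (fresh acc (stream_trace M U)) =
      map (snapshot M0 M1') (fresh acc (stream_trace M' U)) ->
    stream_outputs arr M U = stream_outputs arr M' U.
  by apply: H.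
elim: U acc M M' => //= x U IH acc M M' eqacc E1 E1'.
rewrite !fresh_cat !map_cat => H.
have [-> tE rE mE] := exec_det M0 M1 M1' _ _ _ _ _ _ eqacc E1 E1' H.
congr cons; apply: IH mE _ _ _.
- by move=> a; rewrite mem_cat negb_or => /andP[na /E1 <-]; apply: exec_untouched.
- by move=> a; rewrite tE mem_cat negb_or => /andP[na /E1' <-]; apply: exec_untouched.
- by rewrite rE tE.
Qed.

End CellProbe.

(** * Binary codes and their average length *)

Section Coding.

Context {w : nat}.

(** A binary numeral read from its lowest bit: each entry is a flag, followed by [w] bits if the
    flag is set, and a leading 1 marks the end. *)
Fixpoint code (s : seq (option (cell w))) : nat :=
  if s is o :: s' then
    if o is Some v then (2 ^ w * code s' + enum_rank v).*2.+1 else (code s').*2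
  else 1.

Definition cost (s : seq (option (cell w))) : nat := size s + w * count isSome s.

Lemma rank_lt (v : cell w) : enum_rank v < 2 ^ w.
Proof. by have := ltn_ord (enum_rank v); rewrite {2}card_tuple card_bool. Qed.

Lemma code_gt0 s : 0 < code s.
Proof. by elim: s => //= -[v|] s IH //; rewrite double_gt0. Qed.

Lemma code_lt_exp s : code s < 2 ^ (cost s).+1.
Proof.
rewrite /cost; elim: s => [|[v|] s IH] /=; first by rewrite muln0.
  have -> : ((size s).+1 + w * (1 + count isSome s)).+1 =
      (w + (size s + w * count isSome s).+1).+1 by ring.
  rewrite expnS mul2n ltn_Sdouble expnD.
  apply: (@leq_trans (2 ^ w * (code s).+1)); last by rewrite leq_mul2l IH orbT.
  by rewrite mulnS addnC ltn_add2r rank_lt.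
by rewrite add0n addSn expnS mul2n ltn_double.
Qed.

Lemma code_inj : injective code.
Proof.
elim=> [|[v|] s IH] [|[v'|] s'] //=.
- have := code_gt0 s'; have : 0 < 2 ^ w by rewrite expn_gt0.
  nia.
- by have := code_gt0 s'; lia.
- have := code_gt0 s; have : 0 < 2 ^ w by rewrite expn_gt0.
  nia.
- move=> [/double_inj E].
  have r := rank_lt v; have r' := rank_lt v'.
  have : (2 ^ w * code s + enum_rank v) %/ 2 ^ w =
         (2 ^ w * code s' + enum_rank v') %/ 2 ^ w by rewrite E.
  rewrite ![2 ^ w * _]mulnC !divnMDl ?expn_gt0 // !divn_small // !addn0 => /IH Es.
  by move: E; rewrite Es => /addnI/val_inj/enum_rank_inj ->.
- by move=> E; have := congr1 odd E; rewrite /= !odd_double.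
- by have := code_gt0 s; lia.
- by move=> E; have := congr1 odd E; rewrite /= !odd_double.
- by move=> /double_inj/IH ->.
Qed.

End Coding.

(** Elements with [l x < h] are determined by [r x] and a code below [2 ^ h], so they are at most
    half of [T]; each of the others contributes at least [h]. *)
Lemma average_code_length (T R : finType) (r : T -> R) (c l : T -> nat) (h : nat) :
  (forall x, c x < 2 ^ (l x).+1) ->
  (forall x y, r x = r y -> c x = c y -> x = y) ->
  #|R| * 2 ^ h.+1 <= #|T| ->
  h * #|T| <= 2 * \sum_x l x.
Proof.
move=> clt inj cardR.
have short : 2 * #|[pred x | l x < h]| <= #|T|.
  apply: leq_trans cardR; rewrite expnS mulnCA leq_mul2l /=.
  have -> : #|R| * 2 ^ h = #|{: R * 'I_(2 ^ h)}| by rewrite card_prod card_ord.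
  have e0 : 0 < 2 ^ h by rewrite expn_gt0.
  (* The default 0 never occurs on short elements, whose codes are below [2 ^ h]. *)
  pose g x := (r x, insubd (Ordinal e0) (c x) : 'I_(2 ^ h)).
  rewrite -(@card_in_image _ _ g [pred x | l x < h]) ?max_card // => x y.
  rewrite !inE => lx ly [rE] /(congr1 val); rewrite !val_insubd.
  have cl z : l z < h -> c z < 2 ^ h.
    by move=> lz; apply: leq_trans (clt z) _; rewrite leq_exp2l.
  by rewrite !cl // => cE; apply: inj.
have long : h * #|[predC [pred x | l x < h]]| <= \sum_x l x.
  rewrite mulnC -sum_nat_const [X in _ <= X](bigID [pred x | l x < h]) /=.
  apply: leq_trans (leq_addl _ _); apply: leq_sum => x.
  by rewrite !inE /= -leqNgt.
have := cardC [pred x | l x < h]; move: short long.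
move: #|_| #|_| #|_| (\sum_x _) => a b c' S; nia.
Qed.

(** * Answers as match counts in a sliding window *)

Section Windows.

Variables (Sigma : finType) (n : nat).
Implicit Types (F S : n.-tuple Sigma) (U : seq Sigma).

Lemma nth_answers F S U t : t < size U ->
  nth 0 (answers F S U) t = hamming F (foldl (@shift Sigma n) S (take t.+1 U)).
Proof.
elim: U S t => //= x U IH S [|t] lt_t; first by rewrite take0.
exact: IH.
Qed.

Lemma tnth_window x0 S U i :
  tnth (foldl (@shift Sigma n) S U) i = nth x0 (S ++ U) (size U + i).
Proof.
elim: U S => /= [|x U IH] S; first by rewrite cats0 (tnth_nth x0).
rewrite IH addSn -nth_behead -cat_rcons /=.
by congr (nth _ _ _); case: (tval S).
Qed.

Lemma hamming_matches F S : hamming F S + \sum_(i < n) (tnth F i == tnth S i) = n.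
Proof.
rewrite /hamming -sum1_card big_mkcond -big_split /=.
rewrite (eq_bigr (fun _ => 1)) ?sum_nat_const ?card_ord ?muln1 // => i _.
by rewrite inE; case: eqP.
Qed.

(** Distance and match count add up to [n]. The window is read off the whole of [S ++ U], which is
    harmless since it ends at symbol [t] of [U]. *)
Lemma answers_matches F S U U' t x0 : t < size U -> t < size U' ->
  nth 0 (answers F S U) t = nth 0 (answers F S U') t ->
  \sum_(0 <= i < n) (nth x0 F i == nth x0 (S ++ U) (t.+1 + i)) =
  \sum_(0 <= i < n) (nth x0 F i == nth x0 (S ++ U') (t.+1 + i)).
Proof.
move=> tU tU'; rewrite !nth_answers // => E.
suff sumE V : t < size V ->
    \sum_(0 <= i < n) (nth x0 F i == nth x0 (S ++ V) (t.+1 + i)) =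
    \sum_(i < n) (tnth F i == tnth (foldl (@shift Sigma n) S (take t.+1 V)) i).
  rewrite !sumE //; apply: (@addnI (hamming F (foldl (@shift Sigma n) S (take t.+1 U)))).
  by rewrite hamming_matches E hamming_matches.
move=> tV; rewrite big_mkord; apply: eq_bigr => i _.
rewrite (tnth_window x0) (tnth_nth x0) size_takel //.
congr (nat_of_bool (_ == _)); rewrite !nth_cat size_tuple; case: ifP => // ge.
by rewrite nth_take //; move/negbT: ge; have := ltn_ord i; lia.
Qed.

End Windows.

(** * The hard instance and its random streams *)

Section HardDistribution.

Variables (K q : nat) (f : nat -> nat -> nat -> bool).
Hypotheses (K_gt1 : 1 < K) (q_gt0 : 0 < q) (f0 : forall s k, f s k 0 = false).
Hypothesis weigh : forall x y : nat -> nat,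
  (forall k, k < K -> x k < 2 * q) -> (forall k, k < K -> y k < 2 * q) ->
  (forall s, s < K -> \sum_(k < K) f s k (x k) = \sum_(k < K) f s k (y k)) ->
  forall k, k < K -> x k = y k.
Variables (n m N : nat).

Local Notation L := (superblock K q).
Hypothesis NLm : N * L <= m.

(** The successor form exhibits an inhabited type, as [inord] requires. *)
Definition symbol : finType := 'I_(2 * K * q).-1.+1.
Definition content : finType := {ffun 'I_K * 'I_K -> {perm 'I_q}}.
Definition contents : finType := {ffun 'I_N -> content}.

(* Outside the range of the contents, e.g. for [sg >= N], the identity. *)
Definition perms (om : contents) (sg k rho i : nat) : nat :=
  if (insub sg, insub k, insub rho, insub i) is (Some sg', Some k', Some rho', Some i')
  then (om sg' (k', rho') : {perm 'I_q}) i' else i.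

Definition fixed_string : n.-tuple symbol :=
  [tuple inord (pattern K q f (n.-1 - i)) | i < n].

Definition random_stream (om : contents) : m.-tuple symbol :=
  [tuple inord (stream_symbol K q (perms om) t) | t < m].

Lemma perms_ord om (sg : 'I_N) (k rho : 'I_K) (i : 'I_q) :
  perms om sg k rho i = om sg (k, rho) i.
Proof. by rewrite /perms !valK. Qed.

Lemma perms_eq (om om' : contents) sg :
  (forall sg' : 'I_N, val sg' = sg -> om sg' = om' sg') -> perms om sg = perms om' sg.
Proof.
rewrite /perms; case: insubP => //= sg' _ sgE /(_ _ sgE) -> //.
Qed.

Lemma is_perm_perms om sg k : k < K -> is_perm K q (perms om sg k).
Proof.
move=> kK rho rK; rewrite /perms (insubT (ltn^~ K) kK) (insubT (ltn^~ K) rK).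
case: insubP => [sg' _ _|_] /=; last by split=> // i iq; case: insub.
split=> [i iq|i j iq jq]; first by rewrite (insubT (ltn^~ q) iq) /=.
by rewrite (insubT (ltn^~ q) iq) (insubT (ltn^~ q) jq) /= => /val_inj/perm_inj[].
Qed.

Lemma stream_symbol_lt om u : stream_symbol K q (perms om) u < 2 * K * q.
Proof.
rewrite /stream_symbol; case: ifP => [jlt|_]; last by nia.
have kK : u %/ block K q %% K < K by rewrite ltn_mod; lia.
have pP := is_perm_perms om (u %/ superblock K q) _ kK.
have /andP[_ xq] := coin_bounds K q K_gt1 q_gt0 _ _ pP jlt.
by case: (code_lt K q K_gt1 q_gt0 _ _ _ kK xq jlt).
Qed.

Lemma inord_eq (a b : nat) : a < 2 * K * q -> b < 2 * K * q ->
  ((inord a : symbol) == inord b) = (a == b).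
Proof.
move=> aK bK; have KE : (2 * K * q).-1.+1 = 2 * K * q by lia.
by rewrite -val_eqE /= !inordK ?KE.
Qed.

Lemma nth_random_stream om u : u < m ->
  nth (inord 0) (random_stream om) u = inord (stream_symbol K q (perms om) u).
Proof. by move=> um; rewrite -[u]/(val (Ordinal um)) -tnth_nth tnth_mktuple. Qed.

Lemma nth_fixed_string i : i < n ->
  nth (inord 0) fixed_string i = inord (pattern K q f (n.-1 - i)).
Proof. by move=> lt_i; rewrite -[i]/(val (Ordinal lt_i)) -tnth_nth tnth_mktuple. Qed.

Lemma L_gt0 : 0 < L.
Proof. by rewrite /superblock muln_gt0 block_gt0 //; lia. Qed.

(** * The information transfer bound at one node of the tree *)

Section Node.

Variables (e a : nat).
Hypotheses (e_gt0 : 0 < e) (eLn : (2 ^ e).+1 * L <= n) (aN : a + 2 ^ e.+1 <= N).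

(* The node of level [e] at [a] has children [a, a + 2 ^ e) and
   [a + 2 ^ e, a + 2 ^ (e + 1)).  Only the second half of the left child is
   treated as unknown: when it contains [T - 2 ^ e], no distance from [T] to it is
   another power of 2, so the answers during [T] involve one unknown superblock. *)
Definition hidden (sg : nat) : bool := a + 2 ^ e.-1 <= sg < a + 2 ^ e.

Lemma pow2_half : 2 ^ e = 2 * 2 ^ e.-1.
Proof. by rewrite -expnS prednK. Qed.

Lemma symbol_visible (om om' : contents) u :
  (forall sg : 'I_N, ~~ hidden sg -> om sg = om' sg) -> ~~ hidden (u %/ L) ->
  stream_symbol K q (perms om) u = stream_symbol K q (perms om') u.
Proof.
move=> eqo nh; rewrite /stream_symbol (perms_eq om om') // => sg' E.
by apply: eqo; rewrite E.
Qed.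

(** The hidden superblock [sg] is decoded from the answers during [T = sg + 2 ^ e], in the right
    child. All other matches agree in both streams: they come from [S] or visible superblocks, while
    other hidden ones never match then. Hence the match counts of [sg] agree too. *)
Lemma answers_determine (S : n.-tuple symbol) (om om' : contents) :
  (forall sg : 'I_N, ~~ hidden sg -> om sg = om' sg) ->
  (forall t, a + 2 ^ e <= t %/ L < a + 2 ^ e.+1 ->
     nth 0 (answers fixed_string S (random_stream om)) t =
     nth 0 (answers fixed_string S (random_stream om')) t) ->
  om = om'.
Proof.
move=> eqo eqa; apply/ffunP => sg.
case: (boolP (hidden sg)) => [hsg|/eqo//].
have L0 := L_gt0.
pose T := sg + 2 ^ e.
have TN : T < N.
  by move: aN hsg; rewrite /T /hidden expnS; lia.
apply/ffunP => -[k rho]; apply/permP => i; apply: val_inj.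
rewrite /= -!perms_ord.
apply: (decode K q f K_gt1 q_gt0 f0 weigh _ _ sg T) => //.
- by move=> ? ? ?; apply: is_perm_perms.
- by move=> ? ? ?; apply: is_perm_perms.
- by rewrite /T -addn1 leq_add2l expn_gt0.
- by rewrite /T addKn is_pow2_exp.
move=> t tT.
have tlo : T * L <= t by rewrite -tT leq_trunc_div.
have thi : t < T.+1 * L by rewrite -tT -ltn_divLR.
have tm : t < m.
  by apply: leq_trans thi _; apply: leq_trans NLm; rewrite leq_mul2r TN orbT.
have nodeT : a + 2 ^ e <= t %/ L < a + 2 ^ e.+1.
  by rewrite tT; move: hsg; rewrite /T /hidden expnS pow2_half; lia.
have sgt : sg * L + L <= t.
  apply: leq_trans tlo; rewrite /T -mulSnr leq_mul2r -addn1 leq_add2l.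
  by rewrite expn_gt0 orbT.
(* By [eLn], superblock [sg] is still wholly in the window while [T] arrives. *)
have tn : t < sg * L + n.
  apply: leq_trans thi _; rewrite /T -addnS mulnDl leq_add2l; exact: eLn.
(* The place in the window, at time [t], of the first symbol of superblock [sg]. *)
pose b := n + sg * L - t.+1.
have bn : b + L <= n by rewrite /b; lia.
pose nU om (i : nat) := nat_of_bool (nth (inord 0) fixed_string i ==
    nth (inord 0) (S ++ random_stream om) (t.+1 + i)).
have nUE om0 u j : j < n -> t.+1 + j = n + u -> u <= t ->
    nU om0 j = (stream_symbol K q (perms om0) u == pattern K q f (t - u)).
  move=> lt_j iE ut; rewrite /nU nth_fixed_string // iE nth_cat size_tuple.
  rewrite ltnNge leq_addr /= addKn nth_random_stream ?(leq_ltn_trans ut) //.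
  rewrite eq_sym inord_eq ?stream_symbol_lt ?pattern_lt //.
  by have -> : n.-1 - j = t - u by lia.
have nU_out j : j < n -> ~~ (b <= j < b + L) -> nU om j = nU om' j.
  move=> lt_j out.
  have [lt_tn|ge_tn] := ltnP (t.+1 + j) n.
    by rewrite /nU !nth_cat size_tuple lt_tn.
  pose u := t.+1 + j - n.
  have uE : t.+1 + j = n + u by rewrite /u; lia.
  have ut : u <= t by rewrite /u; lia.
  rewrite !(nUE _ u) //.
  case: (boolP (hidden (u %/ L))) => [hu|hu]; last by rewrite (symbol_visible om om').
  have usg : u %/ L != sg.
    apply: contra out => /eqP us.
    have := leq_trunc_div u L; have : u < (u %/ L).+1 * L by rewrite -ltn_divLR.
    by rewrite us mulSnr /b; lia.
  (* Two hidden superblocks are less than [2 ^ e.-1] apart, so the distance from [T] falls in the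
     range of [is_pow2_eq]; a power of 2 would force superblock [sg] itself. *)
  have npow : ~~ is_pow2 (t %/ L - u %/ L).
    apply: contra usg => /(is_pow2_eq e _ e_gt0); rewrite tT => H; apply/eqP.
    have := pow2_half; have : 0 < 2 ^ e.-1 by rewrite expn_gt0.
    move: hu hsg H; rewrite /T /hidden; move: (2 ^ e) (2 ^ e.-1) (u %/ L) => P P' v.
    move=> /andP[v1 v2] /andP[s1 s2] H P'0 PE.
    have H1 : P' < sg + P - v by lia.
    have H2 : sg + P - v < P + P' by lia.
    by have := H H1 H2; lia.
  by rewrite !match_iff //; [rewrite (negbTE npow) !andbF|
     move=> *; apply: is_perm_perms..].
have mid om0 : \sum_(b <= i < b + L) nU om0 i =
   \sum_(0 <= r < L) (stream_symbol K q (perms om0) (sg * L + r) ==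
      pattern K q f (t - (sg * L + r))).
  rewrite -{1}[b]add0n big_addn addKn big_nat_cond [RHS]big_nat_cond.
  apply: eq_bigr => r /andP[/andP[_ rL] _].
  by rewrite (nUE _ (sg * L + r)) //; rewrite /b; lia.
have := answers_matches _ _ fixed_string S (random_stream om) (random_stream om') t
  (inord 0); rewrite !size_tuple => /(_ tm tm (eqa _ nodeT)).
have cut om0 : \sum_(0 <= i < n) nU om0 i =
    \sum_(0 <= i < b) nU om0 i + \sum_(b <= i < b + L) nU om0 i +
    \sum_(b + L <= i < n) nU om0 i.
  rewrite -big_cat_nat ?leq_addr // -big_cat_nat //.
rewrite -/(nU om) -/(nU om') !cut !mid.
have -> : \sum_(0 <= i < b) nU om i = \sum_(0 <= i < b) nU om' i.
  rewrite big_nat_cond [RHS]big_nat_cond; apply: eq_bigr => j /andP[/andP[_ jb] _].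
  by apply: nU_out; lia.
have -> : \sum_(b + L <= i < n) nU om i = \sum_(b + L <= i < n) nU om' i.
  rewrite big_nat_cond [RHS]big_nat_cond; apply: eq_bigr => j /andP[/andP[bj jn] _].
  by apply: nU_out; lia.
by move=> /addIn/addnI.
Qed.

Variables (w : nat) (A : algorithm symbol w) (S : n.-tuple symbol).
Hypothesis A_solves : solves fixed_string S m A.

Definition segment (om : contents) (x y : nat) : seq symbol :=
  take ((y - x) * L) (drop (x * L) (random_stream om)).

Definition state (om : contents) (x : nat) : memory w :=
  stream_memory (arrive A) (init_mem A) (take (x * L) (random_stream om)).

Definition segment_trace (om : contents) (x y : nat) : seq (bool * nat) :=
  stream_trace (arrive A) (state om x) (segment om x y).

Lemma take_segment om x y : x <= y ->
  take (y * L) (random_stream om) = take (x * L) (random_stream om) ++ segment om x y.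
Proof. by move=> xy; rewrite -takeD mulnBl subnKC // leq_mul2r xy orbT. Qed.

Lemma state_segment om x y : x <= y ->
  state om y = stream_memory (arrive A) (state om x) (segment om x y).
Proof. by move=> xy; rewrite /state (take_segment om x y) // stream_memory_cat. Qed.

Lemma segment_trace_cat om x y z : x <= y -> y <= z ->
  segment_trace om x z = segment_trace om x y ++ segment_trace om y z.
Proof.
move=> xy yz; rewrite /segment_trace (state_segment _ _ _ xy) -stream_trace_cat.
congr stream_trace; apply/eqP.
have : take (x * L) (random_stream om) ++ segment om x z ==
    take (x * L) (random_stream om) ++ (segment om x y ++ segment om y z).
  by rewrite catA -!take_segment // (leq_trans xy).
by rewrite eqseq_cat // eqxx.
Qed.

Lemma outputs_segment om x y t : x <= y -> y <= N -> x <= t %/ L < y ->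
  nth 0 (answers fixed_string S (random_stream om)) t =
  nth 0 (stream_outputs (arrive A) (state om x) (segment om x y)) (t - x * L).
Proof.
move=> xy yN /andP[xt ty]; have L0 := L_gt0.
have xLt : x * L <= t by rewrite -leq_divRL.
have tyL : t < y * L by rewrite -ltn_divLR.
rewrite -A_solves -[in LHS](cat_take_drop (y * L) (random_stream om)).
have yLm : y * L <= m by apply: leq_trans NLm; rewrite leq_mul2r yN orbT.
rewrite stream_outputs_cat nth_cat size_stream_outputs size_takel ?size_tuple // tyL.
rewrite (take_segment om x y) // stream_outputs_cat nth_cat size_stream_outputs.
by rewrite size_takel ?size_tuple ?(leq_trans xLt) 1?ltnNge ?xLt // (leq_trans (ltnW tyL)).
Qed.

Lemma segment_eq (om om' : contents) x y :
  (forall sg : 'I_N, x <= sg < y -> om sg = om' sg) ->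
  segment om x y = segment om' x y.
Proof.
move=> eqo; have L0 := L_gt0.
apply: (@eq_from_nth _ (inord 0)).
  by rewrite !size_take_min !size_drop !size_tuple.
move=> j; rewrite size_take_min size_drop size_tuple leq_min => /andP[jlt jm].
rewrite /segment !nth_take // !nth_drop.
have um : x * L + j < m by lia.
rewrite !nth_random_stream // /stream_symbol (perms_eq om om') // => sg E.
apply: eqo; rewrite E leq_divRL // leq_addr ltn_divLR //.
have xy : x <= y.
  by rewrite leqNgt; apply: contraL jlt => /ltnW; rewrite -subn_eq0 => /eqP ->.
by rewrite -(subnKC xy) mulnDl ltn_add2l.
Qed.

Lemma card_hidden : #|[pred sg : 'I_N | hidden sg]| = 2 ^ e.-1.
Proof.
rewrite -sum1_card -(big_mkord hidden (fun=> 1)) /=.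
have aN' : a + 2 ^ e <= N by apply: leq_trans aN; rewrite leq_add2l leq_exp2l.
have h1 : a + 2 ^ e.-1 <= a + 2 ^ e by rewrite leq_add2l leq_exp2l // leq_pred.
rewrite big_mkcond (big_cat_nat (leq0n (a + 2 ^ e.-1))) ?(leq_trans h1) //=.
rewrite (big_cat_nat h1) //= -!big_mkcond.
rewrite big_nat_cond big_pred0 ?add0n => [|j]; last by rewrite /hidden; lia.
rewrite [X in _ + X]big_nat_cond [X in _ + X]big_pred0 ?addn0 => [|j]; last by rewrite /hidden; lia.
rewrite big_nat_cond.
rewrite (eq_bigl (fun j => (a + 2 ^ e.-1 <= j < a + 2 ^ e) && true)) => [|j]; last first.
  by rewrite /hidden; lia.
by rewrite -big_nat_cond sum_nat_const_nat muln1 subnDl pow2_half; lia.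
Qed.

(** Given the visible contents, the transfer into the right child is an injective code for [om], so
    its average cost is at least [h / 2]. By [nfresh_cat] the transferred cells number at most the
    fresh reads of the two children minus those of the node, a difference written here without
    subtraction. *)
Lemma node_bound (h : nat) : 2 ^ h.+1 <= #|content| ^ (2 ^ e.-1) ->
  h * #|contents| + 2 * (w * \sum_om nfresh (segment_trace om a (a + 2 ^ e.+1))) <=
  2 * (\sum_om (nfresh (segment_trace om (a + 2 ^ e) (a + 2 ^ e.+1)) +
     w * (nfresh (segment_trace om a (a + 2 ^ e)) +
          nfresh (segment_trace om (a + 2 ^ e) (a + 2 ^ e.+1))))).
Proof.
move=> hC.
pose b := a + 2 ^ e.-1; pose c := a + 2 ^ e; pose d := a + 2 ^ e.+1.
have bc : b <= c by rewrite leq_add2l leq_exp2l // leq_pred.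
have cd : c <= d by rewrite leq_add2l leq_exp2l.
have ab : a <= b by rewrite leq_addr.
pose vis : finType := {i : 'I_N | ~~ hidden i}.
pose r (om : contents) : {ffun vis -> content} := [ffun i => om (val i)].
pose cod om := transfer (arrive A) (state om b) (state om c) (segment om c d).
have rP om om' : r om = r om' -> forall sg : 'I_N, ~~ hidden sg -> om sg = om' sg.
  by move=> /ffunP E sg nh; have := E (exist _ sg nh); rewrite !ffunE.
have inj om om' : r om = r om' -> code (cod om) = code (cod om') -> om = om'.
  move=> /rP eqo /code_inj.
  (* Everything before [b] is visible, so the state at [b] can serve as the memory known to the
     decoder. *)
  have stb : state om b = state om' b.
    rewrite /state !(take_segment _ 0 b) // mul0n !take0 (segment_eq om om') //.
    by move=> sg /andP[_ sb]; apply: eqo; rewrite /hidden -/b leqNgt sb.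
  have sgc : segment om c d = segment om' c d.
    apply: segment_eq => sg /andP[cs _]; apply: eqo.
    by rewrite /hidden -/c [sg < c]ltnNge cs andbF.
  rewrite /cod -stb -sgc => /transfer_det eqout.
  apply: (answers_determine S) => // t ht.
  by rewrite !(outputs_segment _ c d) // eqout -sgc.
have cardR : #|{ffun vis -> content}| * 2 ^ h.+1 <= #|contents|.
  rewrite (@card_ffun vis content) (@card_ffun _ content) card_ord card_sig.
  rewrite [X in _ <= _ ^ X](_ : N = #|[pred i : 'I_N | ~~ hidden i]| + 2 ^ e.-1); last first.
    by rewrite -card_hidden -[LHS]card_ord -(cardC [pred sg : 'I_N | hidden sg]) addnC.
  rewrite expnD; exact: leq_mul hC.
have := average_code_length _ _ r (fun om => code (cod om)) (fun om => cost (cod om)) h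
  (fun om => code_lt_exp _) inj cardR.
have costE om : cost (cod om) + w * nfresh (segment_trace om a d) <=
   nfresh (segment_trace om c d) +
   w * (nfresh (segment_trace om a c) + nfresh (segment_trace om c d)).
  rewrite /cost -addnA -mulnDr; apply: leq_add; first by rewrite size_map.
  rewrite leq_mul2l; apply/orP; right.
  rewrite -nfresh_cat -segment_trace_cat ?(leq_trans ab) // addnC leq_add2l.
  rewrite count_map; apply: sub_count => x /=.
  (* A cell changed between [b] and [c] was accessed there, hence is counted in [nfresh_cat]. *)
  rewrite /snapshot; case: eqP => // ne _.
  apply: contraT => nx; case: ne.
  rewrite (state_segment om b c) //; apply: stream_untouched.
  apply: contra nx; rewrite (segment_trace_cat om a b c) // /unzip2 map_cat mem_cat.
  by move=> ->; rewrite orbT.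
move=> H.
have : \sum_om cost (cod om) + w * \sum_om nfresh (segment_trace om a d) <=
   \sum_om (nfresh (segment_trace om c d) +
   w * (nfresh (segment_trace om a c) + nfresh (segment_trace om c d))).
  by rewrite big_distrr -big_split /=; apply: leq_sum => om _; apply: costE.
rewrite -/c -/d; move: H; set X := \sum_om cost _; set Y := w * _; set Z := \sum_om _.
by lia.
Qed.

End Node.

End HardDistribution.

(** * Summation over the nodes of a level and over the levels *)

Lemma leq_sum_nodes (V u w x : nat) (a b d : 'I_V -> nat) :
  (forall i, x + u * (w * a i) <= u * b i + u * (w * d i)) ->
  V * x + u * (w * \sum_i a i) <= u * \sum_i b i + u * (w * \sum_i d i).
Proof.
move=> H; have := @leq_sum _ (index_enum 'I_V) xpredT _ _ (fun i _ => H i).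
by rewrite !big_split /= -!big_distrr /= sum_nat_const card_ord.
Qed.

Section Levels.

Variables (K q : nat) (f : nat -> nat -> nat -> bool).
Hypotheses (K_gt1 : 1 < K) (q_gt0 : 0 < q) (f0 : forall s k, f s k 0 = false).
Hypothesis weigh : forall x y : nat -> nat,
  (forall k, k < K -> x k < 2 * q) -> (forall k, k < K -> y k < 2 * q) ->
  (forall s, s < K -> \sum_(k < K) f s k (x k) = \sum_(k < K) f s k (y k)) ->
  forall k, k < K -> x k = y k.
Variables (n m N0 E kap : nat).
Local Notation N := (N0 * 2 ^ E).
Local Notation L := (superblock K q).
Hypotheses (ELn : 2 ^ E * L <= n) (NLm : N * L <= m).
Hypotheses (kap_gt0 : 0 < kap) (cardC : 2 ^ (2 * kap) <= #|content K q|).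
Variables (w : nat) (A : algorithm (symbol K q) w) (S : n.-tuple (symbol K q)).
Hypothesis A_solves : solves (fixed_string K q f n) S m A.

Local Notation tr := (segment_trace K q m N w A).
Local Notation U := (random_stream K q m N).
Local Notation probes om := (stream_probes (arrive A) (init_mem A) (U om)).

Definition nfresh_level (om : contents K q N) (e : nat) : nat :=
  \sum_(0 <= i < N0 * 2 ^ (E - e)) nfresh (tr om (i * 2 ^ e) (i.+1 * 2 ^ e)).

Lemma size_tr_sum om c v :
  \sum_(0 <= i < v) size (tr om (i * c) (i.+1 * c)) = size (tr om 0 (v * c)).
Proof.
elim: v => [|v IH].
  by rewrite big_nil mul0n /segment_trace /segment subnn mul0n take0.
rewrite big_nat_recr //= IH -size_cat -segment_trace_cat //.
by rewrite leq_mul2r leqnSn orbT.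
Qed.

Lemma nfresh_level_le om e : e <= E -> nfresh_level om e <= probes om.
Proof.
move=> eE; rewrite /nfresh_level.
apply: (@leq_trans (\sum_(0 <= i < N0 * 2 ^ (E - e)) size (tr om (i * 2 ^ e) (i.+1 * 2 ^ e)))).
  by apply: leq_sum => i _; apply: nfresh_le.
rewrite size_tr_sum -size_stream_trace /segment_trace /segment /state mul0n take0 /= drop0 subn0.
set c := _ * L.
by rewrite -{2}[tval (U om)](cat_take_drop c) stream_trace_cat size_cat leq_addr.
Qed.

(** Sum [node_bound] over the nodes spanning [2 ^ e.+1] superblocks: the nodes make up
    [nfresh_level e.+1] and their children [nfresh_level e]. From one level to the next the nodes
    halve in number while the hidden content doubles, so the gain does not depend on [e]. *)
Lemma level_bound e : 0 < e -> e < E ->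
  N0 * kap * 2 ^ (E - 2) * #|contents K q N| + 2 * (w * \sum_om nfresh_level om e.+1) <=
  2 * (\sum_om probes om + w * \sum_om nfresh_level om e).
Proof.
move=> e_gt0 eE.
pose V := N0 * 2 ^ (E - e.+1).
pose h := kap * 2 ^ e.-1.
(* The hidden contents have at least [2 * h] bits, and [h > 0]. *)
have hC : 2 ^ h.+1 <= #|content K q| ^ (2 ^ e.-1).
  apply: (@leq_trans ((2 ^ (2 * kap)) ^ (2 ^ e.-1))); last by rewrite leq_exp2r ?expn_gt0.
  rewrite -expnM leq_exp2l // /h -mulnA mul2n -addnn -addn1 leq_add2l.
  by rewrite muln_gt0 kap_gt0 expn_gt0.
have eLn : (2 ^ e).+1 * L <= n.
  apply: leq_trans ELn; rewrite leq_mul2r; apply/orP; right.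
  by rewrite ltn_exp2l.
have hV : N0 * kap * 2 ^ (E - 2) = V * h.
  rewrite /V /h mulnACA -expnD; congr (_ * 2 ^ _); lia.
have node i : i < V ->
  h * #|contents K q N| + 2 * (w * \sum_om nfresh (tr om (i * 2 ^ e.+1) (i.+1 * 2 ^ e.+1))) <=
  2 * (\sum_om nfresh (tr om ((i.*2).+1 * 2 ^ e) ((i.*2).+2 * 2 ^ e))) +
  2 * (w * \sum_om (nfresh (tr om (i.*2 * 2 ^ e) (i.*2.+1 * 2 ^ e)) +
                    nfresh (tr om ((i.*2).+1 * 2 ^ e) ((i.*2).+2 * 2 ^ e)))).
  move=> iV; pose a := i * 2 ^ e.+1.
  have aN : a + 2 ^ e.+1 <= N.
    rewrite /a -mulSnr -(subnK eE) expnD mulnA leq_mul2r; apply/orP; right; exact: iV.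
  have := node_bound K q f K_gt1 q_gt0 f0 weigh n m N NLm e a e_gt0 eLn aN w A S A_solves h hC.
  have aE : a = i.*2 * 2 ^ e by rewrite /a expnS mulnA muln2.
  have cE : a + 2 ^ e = i.*2.+1 * 2 ^ e by rewrite aE mulSnr.
  have dE : a + 2 ^ e.+1 = i.*2.+2 * 2 ^ e by rewrite aE expnS !mulSnr; lia.
  have dE' : i.+1 * 2 ^ e.+1 = i.*2.+2 * 2 ^ e by rewrite -dE /a mulSnr.
  rewrite cE dE dE' -/a aE => H; apply: leq_trans H _.
  by rewrite big_split -big_distrr mulnDr.
have sums := leq_sum_nodes _ _ _ _ _ _ _ (fun i : 'I_V => node i (ltn_ord i)).
have lowE om : \sum_(i < V) nfresh (tr om (i * 2 ^ e.+1) (i.+1 * 2 ^ e.+1)) =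
    nfresh_level om e.+1 by rewrite /nfresh_level big_mkord.
have highE om : \sum_(i < V) (nfresh (tr om (i.*2 * 2 ^ e) (i.*2.+1 * 2 ^ e)) +
     nfresh (tr om ((i.*2).+1 * 2 ^ e) ((i.*2).+2 * 2 ^ e))) = nfresh_level om e.
  have VE : N0 * 2 ^ (E - e) = V * 2 by rewrite /V -mulnA -expnSr subnSK.
  rewrite /nfresh_level VE big_nat_mul big_mkord; apply: eq_bigr => i _.
  rewrite [i.+1 * 2]mulSnr !muln2 addn2 big_nat_recr //=.
  by rewrite big_nat1.
move: sums; rewrite [X in _ + 2 * (w * X) <= _]exchange_big [X in _ <= 2 * X + _]exchange_big.
rewrite [X in _ <= _ + 2 * (w * X)]exchange_big /=.
rewrite [X in _ + 2 * (w * X) <= _](eq_bigr _ (fun om _ => lowE om)).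
rewrite [X in _ <= _ + 2 * (w * X)](eq_bigr _ (fun om _ => highE om)).
move=> H; rewrite hV -mulnA; apply: leq_trans H _; rewrite mulnDr leq_add2r leq_mul2l /=.
apply: leq_sum => om _.
apply: leq_trans (nfresh_level_le om e (ltnW eE)); rewrite -highE.
by apply: leq_sum => i _; apply: leq_addl.
Qed.

(** Over the levels from 1 to [E.-1] the terms with factor [w] telescope, leaving one total bounded
    by the probes, whereas the flags of the codes cost the number of probes once per level. *)
Lemma stream_bound : 0 < E ->
  E.-1 * (N0 * kap * 2 ^ (E - 2)) * #|contents K q N| <=
  2 * (E.-1 + w) * \sum_om probes om.
Proof.
move=> E_gt0.
have H e : e < E -> e * (N0 * kap * 2 ^ (E - 2)) * #|contents K q N| +
    2 * (w * \sum_om nfresh_level om e.+1) <=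
    2 * (e * \sum_om probes om) + 2 * (w * \sum_om nfresh_level om 1).
  elim: e => [_|e IH eE]; first by rewrite !mul0n.
  have := IH (ltnW eE); have := level_bound e.+1 isT eE.
  set G := N0 * _ * _; set C := #|_|; set T := \sum_om probes om.
  set a := w * _; set b := w * \sum_om nfresh_level om _; set c := w * _.
  have -> : e.+1 * G * C = G * C + e * G * C by ring.
  have -> : e.+1 * T = T + e * T by ring.
  by move: (e * G * C) (G * C) (e * T) => x y z; lia.
have lastE : E.-1 < E by rewrite prednK.
have := H _ lastE => /(leq_trans (leq_addr _ _)) H'; apply: leq_trans H' _.
rewrite -!mulnDr -mulnA leq_mul2l /= mulnDl leq_add2l leq_mul2l; apply/orP; right.
by apply: leq_sum => om _; apply: nfresh_level_le.
Qed.

End Levels.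

(** * Choice of the dimensions of the instance *)

(** The [b] largest factors all exceed [a]. With both equal to [q / 2], this bounds the entropy of a
    random permutation from below. *)
Lemma leq_expn_fact (a b : nat) : a ^ b <= (a + b)`!.
Proof.
elim: b => [|b IH]; first by rewrite fact_gt0.
by rewrite expnS addnS factS leq_mul // -addnS leq_addr.
Qed.

(** A superblock of [K * K * 2 ^ beta.+1] symbols carries [K * K] permutations of [2 ^ beta.-1]
    elements, hence at least [(beta - 2) / 8] bits per symbol. Its length is at most
    [2 ^ (11 * beta)], so [2 ^ E] superblocks fit into the window. *)
Lemma hard_instance (beta E n : nat) : 2 < beta -> 1 < E -> 2 ^ (11 * beta + E) <= n ->
  exists (Sigma : finType) (F : n.-tuple Sigma),
    #|Sigma| <= 2 ^ (6 * beta) /\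
    forall m, n <= m ->
    exists (Omega : finType) (U : Omega -> m.-tuple Sigma),
      0 < #|Omega| /\
      forall (S : n.-tuple Sigma) (w : nat) (A : algorithm Sigma w),
        solves F S m A ->
        E.-1 * (beta - 2) * m * #|Omega| <=
        256 * (E.-1 + w) * \sum_om stream_probes (arrive A) (init_mem A) (U om).
Proof.
move=> beta_gt2 E_gt1 nlo.
have [f [f0 weigh]] := weighing beta (ltnW (ltnW beta_gt2)).
set K := beta * 2 ^ (4 * beta - 1) in weigh.
pose q := 2 ^ beta.-1.
have qE : 2 * q = 2 ^ beta by rewrite -expnS prednK //; lia.
have q_gt0 : 0 < q by rewrite expn_gt0.
have K_gt1 : 1 < K.
  by rewrite /K (leq_trans (ltnW beta_gt2)) // leq_pmulr // expn_gt0.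
rewrite -qE in weigh.
have beta_exp : beta < 2 ^ beta by apply: ltn_expl.
have Kle : K <= 2 ^ (5 * beta - 1).
  have -> : 5 * beta - 1 = beta + (4 * beta - 1) by lia.
  by rewrite expnD leq_mul // ltnW.
clearbody K.
have LE : superblock K q = K * K * 2 ^ beta.+1.
  by rewrite /superblock /block expnS -qE; ring.
have Lle : superblock K q <= 2 ^ (11 * beta).
  rewrite LE.
  have -> : 11 * beta = (5 * beta - 1) + (5 * beta - 1) + beta.+2 by lia.
  by rewrite !expnD leq_mul ?leq_mul // leq_exp2l.
have ELn : 2 ^ E * superblock K q <= n.
  by apply: leq_trans nlo; rewrite addnC expnD leq_mul2l Lle orbT.
exists (symbol K q), (fixed_string K q f n); split.
  rewrite card_ord prednK ?muln_gt0 ?q_gt0 ?(ltnW K_gt1) //.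
  rewrite mulnAC qE mulnC.
  have -> : 6 * beta = (5 * beta - 1) + beta.+1 by lia.
  by rewrite expnD leq_mul // leq_exp2l.
move=> m nm.
pose N0 := m %/ (2 ^ E * superblock K q).
have EL_gt0 : 0 < 2 ^ E * superblock K q.
  by rewrite LE !muln_gt0 !expn_gt0 (ltnW K_gt1).
have N0_gt0 : 0 < N0 by rewrite divn_gt0 // (leq_trans ELn).
have NLm : N0 * 2 ^ E * superblock K q <= m by rewrite -mulnA leq_trunc_div.
(* As [N0] is positive, rounding [m] down loses at most half of it. *)
have m_lt : m <= 2 * (N0 * 2 ^ E * superblock K q).
  have : m < N0.+1 * (2 ^ E * superblock K q) by rewrite -ltn_divLR.
  have : 1 * (2 ^ E * superblock K q) <= N0 * (2 ^ E * superblock K q)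
    by rewrite leq_mul2r N0_gt0 orbT.
  by rewrite -!mulnA mulSn; lia.
exists (contents K q (N0 * 2 ^ E)), (random_stream K q m (N0 * 2 ^ E)); split.
  by apply/card_gt0P; exists ([ffun=> [ffun=> 1%g]] : contents K q (N0 * 2 ^ E)).
move=> S w A A_solves.
pose kap := K * K * ((beta - 2) * 2 ^ (beta - 3)).
have kap_gt0 : 0 < kap.
  by rewrite !muln_gt0 !expn_gt0 subn_gt0 beta_gt2 (ltnW K_gt1).
have cardC : 2 ^ (2 * kap) <= #|content K q|.
  rewrite card_ffun card_prod card_ord card_Sn.
  have -> : 2 * kap = (beta - 2) * 2 ^ (beta - 2) * (K * K).
    rewrite /kap; have -> : beta - 2 = (beta - 3).+1 by lia.
    by rewrite [2 ^ _.+1]expnS; ring.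
  rewrite expnM leq_exp2r ?muln_gt0 ?(ltnW K_gt1) // expnM.
  have -> : q = 2 ^ (beta - 2) + 2 ^ (beta - 2).
    by rewrite addnn -mul2n -expnS /q; congr (2 ^ _); lia.
  exact: leq_expn_fact.
have := stream_bound K q f K_gt1 q_gt0 f0 weigh n m N0 E kap ELn NLm kap_gt0 cardC
  w A S A_solves (ltnW E_gt1).
set T := \sum_om _; set Om := #|_| => main.
(* Here 128 is 2 for rounding [m], times 4 from [2 ^ (E - 2)] and 16 from [2 ^ (beta - 3)]. *)
have mE : (beta - 2) * m <= 128 * (N0 * kap * 2 ^ (E - 2)).
  have -> : 128 * (N0 * kap * 2 ^ (E - 2)) =
     (beta - 2) * (2 * (N0 * 2 ^ E * superblock K q)).
    rewrite LE /kap.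
    have -> : 2 ^ E = 4 * 2 ^ (E - 2) by rewrite -(expnD 2 2); congr (2 ^ _); lia.
    have -> : 2 ^ beta.+1 = 16 * 2 ^ (beta - 3) by rewrite -(expnD 2 4); congr (2 ^ _); lia.
    ring.
  by rewrite leq_mul2l m_lt orbT.
have -> : 256 * (E.-1 + w) * T = 128 * (2 * (E.-1 + w) * T) by ring.
apply: leq_trans (_ : 128 * (E.-1 * (N0 * kap * 2 ^ (E - 2)) * Om) <= _); last first.
  by rewrite leq_mul2l main orbT.
have -> : 128 * (E.-1 * (N0 * kap * 2 ^ (E - 2)) * Om) =
   E.-1 * (128 * (N0 * kap * 2 ^ (E - 2))) * Om by ring.
by rewrite leq_mul2r -[_ * _ * m]mulnA leq_mul2l mE !orbT.
Qed.

(** * Bounded [delta]: one probe per arrival *)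

Lemma exec_no_probe (w : nat) (t : probe_tree w) :
  (exists o, t = Output w o) \/ (forall M, 0 < probes (exec t M)).
Proof. by case: t => [o|a k|a v t]; [left; exists o|right..]. Qed.

(* Without a probe the answer to [x] would be the same at every arrival of [x]. *)
Lemma probe_each_arrival (n m w : nat) (S : n.-tuple bool) (A : algorithm bool w) :
  1 < n -> n <= m -> solves [tuple true | _ < n] S m A ->
  forall U : seq bool, size U <= stream_probes (arrive A) (init_mem A) U.
Proof.
move=> n_gt1 nm A_solves.
have probing x M : 0 < probes (exec (arrive A x) M).
  have [[o oE]|//] := exec_no_probe w (arrive A x).
  (* After [n] arrivals the window of [V y] is [n.-1] copies of [y] followed by [x]. *)
  pose V (y : bool) : m.-tuple bool := [tuple if (i < n.-1) then y else x | i < m].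
  have nthV y i : i < m -> nth false (V y) i = if i < n.-1 then y else x.
    by move=> lt_m; rewrite -[i in nth _ _ i]/(val (Ordinal lt_m)) -tnth_nth tnth_mktuple.
  have lt_m : n.-1 < m by lia.
  have out_o y : nth 0 (stream_outputs (arrive A) (init_mem A) (V y)) n.-1 = o.
    have sV : n.-1 < size (V y) by rewrite size_tuple.
    rewrite -[tval (V y)](cat_take_drop n.-1) (drop_nth false) // nthV // ltnn.
    rewrite stream_outputs_cat nth_cat size_stream_outputs size_takel ?(ltnW sV) //.
    by rewrite ltnn subnn /= oE.
  have := answers_matches _ _ [tuple true | _ < n] S (V true) (V false) n.-1 false.
  rewrite !size_tuple -!A_solves !out_o => /(_ lt_m lt_m erefl).
  have term y i : i < n ->
      nth false [tuple true | _ < n] i == nth false (S ++ V y) (n.-1.+1 + i) =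
      (if i < n.-1 then y else x).
    move=> lt_i.
    have -> : nth false [tuple true | _ < n] i = true.
      by have := tnth_mktuple (fun=> true) (Ordinal lt_i); rewrite (tnth_nth false).
    rewrite prednK ?(ltnW n_gt1) // nth_cat size_tuple ltnNge leq_addr /=.
    by rewrite addKn nthV; [case: ifP|exact: leq_trans lt_i nm].
  have sumE y : \sum_(0 <= i < n)
      (nth false [tuple true | _ < n] i == nth false (S ++ V y) (n.-1.+1 + i)) =
      y + \sum_(1 <= i < n) (if i < n.-1 then y else x).
    rewrite big_ltn ?(ltnW n_gt1) // term ?(ltnW n_gt1) //.
    have -> : 0 < n.-1 by lia.
    congr (_ + _); rewrite big_nat_cond [RHS]big_nat_cond.
    by apply: eq_bigr => i /andP[/andP[_ lt_i] _]; rewrite term.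
  rewrite !sumE add0n => E.
  (* The first window position contributes [y] and the others no less for [true] than for [false],
     so the two match counts cannot be equal. *)
  suff : \sum_(1 <= i < n) (if i < n.-1 then false else x) <=
         \sum_(1 <= i < n) (if i < n.-1 then true else x) by rewrite -E add1n ltnn.
  by apply: leq_sum => i _; case: ifP.
move=> U; elim: U (init_mem A) => //= x U IH M.
by rewrite -add1n leq_add.
Qed.

(* Expectations, randomised algorithms and the final constants *)
From mathcomp Require Import all_classical all_reals all_analysis.
From mathcomp Require Import measurable_realfun lra.

Local Open Scope ring_scope.

Lemma sum_pushforward (R : realType) (Omega X : finType) (U : Omega -> X) (g : X -> R) :
  \sum_x ((\sum_om (U om == x)%:R) / #|Omega|%:R) * g x =
  (\sum_om g (U om)) / #|Omega|%:R.
Proof.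
rewrite mulr_suml.
under eq_bigr do rewrite mulrAC mulr_suml mulr_suml.
rewrite exchange_big /=; apply: eq_bigr => om _.
rewrite (bigD1 (U om)) //= eqxx mul1r big1 ?addr0 // => x /negbTE.
by rewrite eq_sym => ->; rewrite !mul0r.
Qed.

Lemma pushforward_distribution (R : realType) (Omega X : finType) (U : Omega -> X) :
  (0 < #|Omega|)%N ->
  is_distribution (fun x => (\sum_om (U om == x)%:R) / #|Omega|%:R : R).
Proof.
move=> Omega_gt0; split=> [x|].
  by rewrite divr_ge0 // sumr_ge0.
have := @sum_pushforward R _ _ U (fun=> 1).
under eq_bigr do rewrite mulr1.
by move=> ->; rewrite sumr_const divff // pnatr_eq0 -lt0n.
Qed.

(** The easy direction of Yao's principle: were every expectation below [b], their sum, which is the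
    integral of the pointwise sum, would be below [b * #|Omega|]. *)
Lemma exists_expectation_ge (R : realType) (d : measure_display) (T : measurableType d)
    (P : probability T R) (Omega : finType) (f : Omega -> T -> R) (b : R) :
  (0 < #|Omega|)%N ->
  (forall om, measurable_fun setT (f om)) ->
  (forall om t, 0 <= f om t) -> 0 <= b ->
  {ae P, forall t, b * #|Omega|%:R <= \sum_om f om t} ->
  exists om, (b%:E <= 'E_P[f om])%E.
Proof.
move=> Omega_gt0 mf f_ge0 b_ge0 ae_le.
apply: contrapT => /forallNP none.
have lt_b om : ('E_P[f om] < b%:E)%E by rewrite ltNge; apply/negP/none.
have Ef om : ('E_P[f om] = \int[P]_t (f om t)%:E)%E by rewrite unlock.
(* Finiteness allows the strict inequalities to be added in [R]. *)
have Efin om : exists r : R, ('E_P[f om] = r%:E)%E.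
  have := lt_b om; have : (0 <= 'E_P[f om])%E.
    by rewrite Ef; apply: integral_ge0 => t _; rewrite lee_fin.
  by case: ('E_P[f om])%E => [r| |] //; exists r.
have [r rE] := boolp.choice Efin.
have mfE om := (@measurable_EFinP _ _ _ setT (f om)).2 (mf om).
have : ((b * #|Omega|%:R)%:E <= \sum_om 'E_P[f om])%E.
  under eq_bigr do rewrite Ef.
  rewrite -ge0_integral_sum //; last by move=> om t _; rewrite lee_fin.
  have <- : (\int[P]_t (b * #|Omega|%:R)%:E = (b * #|Omega|%:R)%:E)%E.
    rewrite integral_cst //. by rewrite [X in (_ * X)%E](probability_setT P) mule1.
  apply: ae_ge0_le_integral => //.
  - by move=> t _; rewrite lee_fin mulr_ge0.
  - by move=> t _; apply: sume_ge0 => om _; rewrite lee_fin.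
  - by apply: emeasurable_sum.
  by apply: filterS ae_le => t le_t _; rewrite sumEFin lee_fin.
under eq_bigr do rewrite rE.
rewrite sumEFin lee_fin leNgt => /negP; apply.
have -> : b * #|Omega|%:R = \sum_(om in Omega) b by rewrite sumr_const mulr_natr.
have /card_gt0P[om0 _] := Omega_gt0.
rewrite (bigD1 om0) //= [ltRHS](bigD1 om0) //=; apply: ltr_leD.
  by rewrite -lte_fin -rE.
by apply: ler_sum => om _; rewrite ltW // -lte_fin -rE.
Qed.

(** Streams are distributed as [U om] for uniform [om]. A randomised algorithm satisfies the
    deterministic bound for almost every fixing of its random choices, and averaging then selects
    one stream. *)
Lemma hard_samples (R : realType) (Sigma : finType) (n m w : nat) (F : n.-tuple Sigma)
    (b : R) (Omega : finType) (U : Omega -> m.-tuple Sigma) :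
  (0 < #|Omega|)%N -> 0 <= b ->
  (forall (S : n.-tuple Sigma) (A : algorithm Sigma w), solves F S m A ->
     b * #|Omega|%:R <= \sum_om amortised_time R A (U om)) ->
  exists D : m.-tuple Sigma -> R, is_distribution D /\
  forall S : n.-tuple Sigma,
    (forall A : algorithm Sigma w,
       solves F S m A ->
       b <= \sum_(U : m.-tuple Sigma) D U * amortised_time R A U) /\
    (forall (d : measure_display) (T : measurableType d) (P : probability T R)
            (A : T -> algorithm Sigma w),
       randomised_solves F S m P A ->
       exists U : m.-tuple Sigma,
         (b%:E <= 'E_P[fun omega => amortised_time R (A omega) U])%E).
Proof.
move=> Omega_gt0 b_ge0 hard.
exists (fun x => (\sum_om (U om == x)%:R) / #|Omega|%:R); split.
  exact: pushforward_distribution.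
move=> S; split=> [A A_solves|d T P A [mA A_solves]].
  by rewrite sum_pushforward ler_pdivlMr ?ltr0n //; apply: (hard S).
have [om le_om] : exists om, (b%:E <= 'E_P[fun t => amortised_time R (A t) (U om)])%E.
  apply: exists_expectation_ge => //.
    by move=> om t; rewrite /amortised_time divr_ge0.
  by apply: filterS A_solves => t; apply: hard.
by exists (U om).
Qed.

Lemma log2_trunc (R : realType) (n : nat) : (0 < n)%N ->
  (trunc_log 2 n)%:R <= log2 (n%:R : R) /\ log2 (n%:R : R) <= (trunc_log 2 n).+1%:R.
Proof.
move=> n_gt0; have ln2 : 0 < ln (2 : R) by rewrite ln_gt0 // ltr1n.
rewrite /log2 ler_pdivlMr // ler_pdivrMr // ![_%:R * _]mulr_natl -!lnXn //.
rewrite !ler_ln ?posrE ?exprn_gt0 ?ltr0n // -!natrX !ler_nat.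
by rewrite trunc_logP // ltnW // trunc_log_ltn.
Qed.

(** [beta] is the smaller of [delta %/ 6], which keeps the alphabet within [2 ^ delta], and
    [nu %/ 22], which leaves at least half of [nu] to the levels. The thresholds 18 and 66 make it
    at least 3. *)
Lemma choose_parameters (delta nu : nat) : (18 <= delta)%N -> (66 <= nu)%N ->
  exists beta E : nat,
    [/\ (2 < beta)%N /\ (1 < E)%N, (11 * beta + E = nu)%N,
        (E.-1 <= nu)%N /\ (nu.+1 <= 4 * E.-1)%N,
        (6 * beta <= delta)%N /\ (beta <= 3 * (beta - 2))%N &
        (delta <= 12 * beta)%N \/ (nu.+1 <= 44 * beta)%N].
Proof.
move=> delta_ge nu_ge.
have := leq_trunc_div delta 6; have := ltn_ceil delta (isT : 0 < 6)%N.
have := leq_trunc_div nu 22; have := ltn_ceil nu (isT : 0 < 22)%N.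
move: (delta %/ 6)%N (nu %/ 22)%N => x y y1 y2 x1 x2.
exists (minn x y), (nu - 11 * minn x y)%N.
by case: (leqP x y) => xy; split; lia.
Qed.

Theorem theorem1 (R : realType) (C : R) :
  exists (c : R) (n0 : nat), 0 < c /\
  forall (n delta w : nat),
    (0 < n)%N -> (n0 <= n)%N -> (0 < delta)%N ->
    delta%:R <= C * log2 n%:R ->
    log2 (n%:R : R) <= w%:R ->
  exists (Sigma : finType) (F : n.-tuple Sigma),
    (#|Sigma| <= 2 ^ delta)%N /\
  forall m : nat, (n <= m)%N ->
  exists D : m.-tuple Sigma -> R, is_distribution D /\
  forall S : n.-tuple Sigma,
    (forall A : algorithm Sigma w,
       solves F S m A ->
       c * (delta%:R / w%:R * log2 n%:R) <=
         \sum_(U : m.-tuple Sigma) D U * amortised_time R A U) /\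
    (forall (d : measure_display) (T : measurableType d) (P : probability T R)
            (A : T -> algorithm Sigma w),
       randomised_solves F S m P A ->
       exists U : m.-tuple Sigma,
         ((c * (delta%:R / w%:R * log2 n%:R))%:E <=
            'E_P[fun omega => amortised_time R (A omega) U])%E).
Proof.
pose C1 : R := Num.max C 1.
have C1_ge1 : 1 <= C1 by rewrite le_max lexx orbT.
(* The factor [528 * C1] is [44 * C1] from [delta] against [beta], 3 from [beta] against [beta - 2]
   and 4 from [lg] against [E.-1]; 512 is 256 times 2, from [E.-1 + w <= 2 * w]. *)
pose c : R := (528 * 512 * C1)^-1.
have c_gt0 : 0 < c by rewrite invr_gt0; lra.
have cC1 : c * C1 * (528 * 512) = 1.
  by rewrite /c; field; rewrite lt0r_neq0 //; lra.
have [n0 n0P] : exists n0 : nat, forall n, (n0 <= n)%N -> (66 <= trunc_log 2 n)%N.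
  by exists (2 ^ 66)%N => n n0n; apply: trunc_log_max n0n.
exists c, n0; split=> // n delta w n_gt0 n0n delta_gt0 deltaC lgw.
have [nu_lg lg_nu] := log2_trunc R n n_gt0.
set lg := log2 n%:R in deltaC lgw nu_lg lg_nu *.
set nu := trunc_log 2 n in nu_lg lg_nu.
have nu66 : (66 <= nu)%N by apply: n0P.
have nu66R : 66 <= nu%:R :> R by rewrite (ler_nat _ 66).
have w_gt0 : 0 < w%:R :> R by lra.
have lg_ge0 : 0 <= lg by lra.
have b_ge0 : 0 <= c * (delta%:R / w%:R * lg).
  apply: mulr_ge0; first exact: ltW.
  by apply: mulr_ge0 => //; apply: divr_ge0.
(* For small [delta] the claimed bound is at most [18 * c <= 1], because [lg <= w]. *)
have [delta_small|delta_big] := ltnP delta 18.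
  exists bool, [tuple true | _ < n]; split.
    by rewrite card_bool -[X in (X <= _)%N]expn1 leq_exp2l.
  move=> m nm; apply: (@hard_samples _ _ _ _ _ _ _ unit (fun=> [tuple true | _ < m])) => //.
    by rewrite card_unit.
  move=> S A A_solves; rewrite card_unit mulr1 (big_pred1 tt); last by case.
  have n_gt1 : (1 < n)%N
    by move: n_gt0 (n0P n n0n); case: (n) => [|[|]] //; rewrite trunc_log1.
  apply: (@le_trans _ _ 1); last first.
    rewrite ler_pdivlMr ?ltr0n ?(leq_trans n_gt0) // mul1r ler_nat.
    have := @probe_each_arrival n m w S A n_gt1 nm A_solves [tuple true | _ < m].
    by rewrite size_tuple.
  have lgw1 : lg / w%:R <= 1 by rewrite ler_pdivrMr // mul1r.
  have lgw0 : 0 <= lg / w%:R by apply: divr_ge0.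
  have d18 : delta%:R <= 18 :> R by rewrite (ler_nat _ _ 18) ltnW.
  have c18 : c * 18 <= 1.
    have : 0 <= c * (C1 - 1) by rewrite mulr_ge0 ?subr_ge0 // ltW.
    by lra.
  have cd0 : 0 <= c * delta%:R by apply: mulr_ge0 => //; apply: ltW.
  have cd1 : c * delta%:R <= 1 by apply: le_trans c18; rewrite ler_pM2l.
  by rewrite -[_ / _ * lg]mulrA [_^-1 * lg]mulrC mulrA; apply: mulr_ile1.
have [beta [E [[beta_gt2 E_gt1] nuE [E_le E_big] [beta_delta beta_le3] beta_big]]] :=
  choose_parameters _ _ delta_big nu66.
(* Either [beta] is proportional to [delta], or it is proportional to [log n] and the assumption
   [delta <= C * log n] applies. *)
have delta_beta : delta%:R <= 44 * C1 * beta%:R.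
  case: beta_big => [d12|nu44].
    have : delta%:R <= 12 * beta%:R :> R by rewrite -natrM ler_nat.
    have : 0 <= beta%:R :> R by [].
    by nra.
  have : nu.+1%:R <= 44 * beta%:R :> R by rewrite -natrM ler_nat.
  have CC1 : C <= C1 by rewrite le_max lexx.
  by nra.
have nlo : (2 ^ (11 * beta + E) <= n)%N by rewrite nuE trunc_logP.
have [Sigma [F [cardS hard]]] := hard_instance beta E n beta_gt2 E_gt1 nlo.
exists Sigma, F; split.
  by apply: leq_trans cardS _; rewrite leq_exp2l.
move=> m nm; have [I [U [I_gt0 hardU]]] := hard m nm.
apply: (@hard_samples _ _ _ _ _ _ _ I U) => // S A A_solves.
rewrite /amortised_time -mulr_suml -natr_sum ler_pdivlMr ?ltr0n ?(leq_trans n_gt0) //.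
have := hardU S w A A_solves; rewrite -(ler_nat R).
set T := (\sum_om _)%N; rewrite !natrM natrD.
have e_w : E.-1%:R <= w%:R :> R.
  by apply: le_trans lgw; apply: le_trans nu_lg; rewrite ler_nat.
have lg_e : lg <= 4 * E.-1%:R.
  by apply: le_trans lg_nu _; rewrite -natrM ler_nat.
have beta_le : beta%:R <= 3 * (beta - 2)%:R :> R.
  by rewrite -natrM ler_nat.
have mO_ge0 : 0 <= m%:R * #|I|%:R :> R by rewrite mulr_ge0.
have T_ge0 : 0 <= T%:R :> R by [].
have eb_ge0 : 0 <= E.-1%:R * (beta - 2)%:R :> R by rewrite mulr_ge0.
have delta_le : delta%:R <= 132 * C1 * (beta - 2)%:R.
  apply: le_trans delta_beta _.
  have : 44 * C1 * beta%:R <= 44 * C1 * (3 * (beta - 2)%:R) by rewrite ler_wpM2l //; lra.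
  by move=> H; apply: le_trans H _; lra.
have rate : c * delta%:R * lg * 512 <= E.-1%:R * (beta - 2)%:R.
  have dlg : delta%:R * lg <= 132 * C1 * (beta - 2)%:R * (4 * E.-1%:R) by apply: ler_pM.
  have : c * (delta%:R * lg) <= c * (132 * C1 * (beta - 2)%:R * (4 * E.-1%:R)).
    by rewrite ler_pM2l.
  have -> : c * (132 * C1 * (beta - 2)%:R * (4 * E.-1%:R)) =
     c * C1 * (528 * 512) * (E.-1%:R * (beta - 2)%:R) / 512 by field.
  by rewrite cC1; lra.
move=> bound; rewrite -(ler_pM2r w_gt0).
have -> : c * (delta%:R / w%:R * lg) * #|I|%:R * m%:R * w%:R =
   (c * delta%:R * lg) * (m%:R * #|I|%:R) by field; rewrite lt0r_neq0.
have := ler_wpM2r mO_ge0 rate.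
have : (256 * (E.-1%:R + w%:R)) * T%:R <= (512 * w%:R) * T%:R :> R.
  by rewrite ler_wpM2r //; lra.
by move: bound; lra.
Qed.
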